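(* Let $q\in(0,1)$ and $N\ge1$. For every $\nu\in\mathrm{Sign}_N$ and the state $\chi_\nu(x)=\mathrm{Tr}(F_\nu x_\nu)/\dim_q(\nu)$ on $W^*(U_q(N))$, $$\Phi^{(N)}_{\chi_\nu}(z_1,\dots,z_N):=(\chi_\nu\otimes\pi_{T^N})(V_N)(z_1,\dots,z_N)=\frac{s_\nu(z_1,q^{-2}z_2,\dots,q^{-2(N-1)}z_N)}{s_\nu(1,q^{-2},\dots,q^{-2(N-1)})}$$ for $(z_1,\dots,z_N)\in\mathbb T^N$. Moreover, for every probability measure $P_N$ on $\mathrm{Sign}_N$ and $\chi:=\sum_{\nu\in\mathrm{Sign}_N}P_N(\nu)\chi_\nu$, $$\Phi^{(N)}_{\chi}(z_1,\dots,z_N):=(\chi\otimes\pi_{T^N})(V_N)(z_1,\dots,z_N)=\sum_{\nu\in\mathrm{Sign}_N}P_N(\nu)\,\Phi^{(N)}_{\chi_\nu}(z_1,\dots,z_N).$$ Therefore $$\Phi^{(N)}_\chi(z_1,\dots,z_N)=\mathcal S(z_1,q^{-2}z_2,\dots,q^{-2(N-1)}z_N;P_N).$$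
   Context: **Compact quantum groups.** A compact quantum group $G=(A,\delta)$ is a unital $C^*$-algebra $A$ with a unital $*$-homomorphism $\delta:A\to A\otimes A$ (minimal tensor product) such that $(\mathrm{id}\otimes\delta)\delta=(\delta\otimes\mathrm{id})\delta$ and $\delta(A)(A\otimes1)$, $\delta(A)(1\otimes A)$ are dense in $A\otimes A$. A finite-dimensional representation on $V$ is an invertible $U\in B(V)\otimes A$ with $(\mathrm{id}\otimes\delta)(U)=U_{12}U_{13}$; unitary if $V$ is a Hilbert space and $U$ is unitary. $\mathrm{Mor}(U,V)=\{T:(T\otimes1)U=V(T\otimes1)\}$, $\mathrm{End}(U)=\mathrm{Mor}(U,U)$; $U$ is irreducible if $\mathrm{End}(U)=\mathbb C1$. $\widehat G$ is the set of unitary equivalence classes of irreducible unitary representations. The contragredient is $U^c=(j\otimes\mathrm{id})(U^{-1})$ with $j:B(\mathcal H)\to B(\mathcal H^* )$ the transpose map. For each finite-dimensional unitary $U$ there is a unique positive invertible $F_U\in\mathrm{Mor}(U,U^{cc})$ with $\mathrm{Tr}(F_U\,\cdot)=\mathrm{Tr}(F_U^{-1}\,\cdot)$ on $\mathrm{End}(U)$ (the density matrix). With representatives $U_\pi\in B(\mathcal H_\pi)\otimes A$, $F_\pi:=F_{U_\pi}$, $\dim_q(\pi):=\mathrm{Tr}(F_\pi)$. $W^*(G)$ is identified with the von Neumann algebra of norm-bounded families $(x_\pi)_{\pi\in\widehat G}\in\prod_\pi B(\mathcal H_\pi)$. **Quantum unitary groups.** $U_q(N)=(A_N,\delta_N)$,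 where $A_N$ is the universal $C^*$-algebra of the Hopf $*$-algebra generated by $u_{ij}=u_{ij}(N)$ ($1\le i,j\le N$) and $\det_q^{-1}(N)$ with relations $u_{ij}u_{kj}=q\,u_{kj}u_{ij}$ ($i<k$); $u_{ij}u_{il}=q\,u_{il}u_{ij}$ ($j<l$); $u_{ij}u_{kl}=u_{kl}u_{ij}$ ($i<k,\ j>l$); $u_{ij}u_{kl}-q\,u_{il}u_{kj}=u_{kl}u_{ij}-q^{-1}u_{kj}u_{il}$ ($i<k,\ j<l$); $\det_q^{-1}(N)$ commutes with all $u_{ij}$ and is the inverse of the quantum determinant $\det_q(N)=\sum_{\sigma\in S_N}(-q)^{\ell(\sigma)}u_{1\sigma(1)}\cdots u_{N\sigma(N)}$; $\delta_N(u_{ij})=\sum_ku_{ik}\otimes u_{kj}$; $u_{ij}^*=S(u_{ji})$ ($S$ the antipode). **Irreducible representations.** $\mathrm{Sign}_N=\{\nu\in\mathbb Z^N:\nu_1\ge\dots\ge\nu_N\}$, $|\nu|=\sum_i\nu_i$. The set $\widehat{U_q(N)}$ is parametrized by $\mathrm{Sign}_N$: $U_\nu\in B(\mathcal H_\nu)\otimes A_N$ is the irreducible unitary representation with highest weight $(q^{\nu_1/2},\dots,q^{\nu_N/2})$ as a module over the quantum universal enveloping algebra of $\mathfrak{gl}(N)$. It has a Gelfand--Tsetlin basis $(v_t)$ indexed by sequences $t=(\nu^{(1)}\prec\nu^{(2)}\prec\cdots\prec\nu^{(N)}=\nu)$, $\nu^{(n)}\in\mathrm{Sign}_n$, where $\mu\prec\lambda$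 means $\lambda_1\ge\mu_1\ge\lambda_2\ge\dots\ge\mu_n\ge\lambda_{n+1}$ for $\mu\in\mathrm{Sign}_n$, $\lambda\in\mathrm{Sign}_{n+1}$; $v_t$ is a weight vector of weight $(q^{|\nu^{(1)}|/2},q^{(|\nu^{(2)}|-|\nu^{(1)}|)/2},\dots,q^{(|\nu^{(N)}|-|\nu^{(N-1)}|)/2})$. In this basis the density matrix $F_\nu$ is diagonal, its $t$-th diagonal entry being $q^{-(N-1)|\nu|+2\sum_{n=1}^{N-1}|\nu^{(n)}|}$. **Torus and Schur polynomials.** $\pi_{T^N}:A_N\to C(\mathbb T^N)$ is the $*$-homomorphism $u_{ij}(N)\mapsto\delta_{i,j}t_i$, $\det_q^{-1}(N)\mapsto t_1^{-1}\cdots t_N^{-1}$, with $t_i(z_1,\dots,z_N)=z_i$. The rational Schur polynomial is $s_\nu(x_1,\dots,x_N)=\det[x_i^{\nu_j+N-j}]_{i,j}/\prod_{i<j}(x_i-x_j)$. **$V_N$ and slices.** $V_N=(U_\nu)_{\nu\in\mathrm{Sign}_N}\in\bigoplus_\nu B(\mathcal H_\nu)\otimes A_N\cong W^*(U_q(N))\otimes A_N$. For $\chi=\sum_\nu\varphi_\nu$ on $W^*(U_q(N))$ ($\varphi_\nu\in B(\mathcal H_\nu)^*$, $\sum_\nu\|\varphi_\nu\|<\infty$), $(\chi\otimes\pi_{T^N})(V_N)=\sum_\nu(\varphi_\nu\otimes\pi_{T^N})(U_\nu)\in C(\mathbb T^N)$. **Generating function.** For a probability measure $P_N$ on $\mathrm{Sign}_N$,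 $$\mathcal S(x_1,\dots,x_N;P_N)=\sum_{\nu\in\mathrm{Sign}_N}P_N(\{\nu\})\frac{s_\nu(x_1,\dots,x_N)}{s_\nu(1,q^{-2},\dots,q^{-2(N-1)})},$$ which converges uniformly on $\{(x_1,\dots,x_N):|x_i|=q^{-2(i-1)},\ i=1,\dots,N\}$.
   Formalization: The density matrix F_U is taken in Mor(U^cc,U) instead of Mor(U,U^cc): for N≥2 the literal orientation contradicts the stated formula for the diagonal entries of F_ν and makes the claim false (N=2, ν=(1,0)). *)

(* Defs.v *)
From HB Require Import structures.
From mathcomp Require Import all_boot all_order all_fingroup all_algebra.
From mathcomp Require Import finmap.
From mathcomp Require Import all_classical all_reals all_analysis.
From mathcomp Require Import complex.
Set Implicit Arguments.
Unset Strict Implicit.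
Unset Printing Implicit Defensive.
Import Order.TTheory GRing.Theory Num.Theory numFieldNormedType.Exports.
Local Open Scope classical_set_scope.
Local Open Scope ring_scope.

HB.mixin Record isCStar (R : realType) A of GRing.Algebra R[i] A := {
  star : A -> A;
  cnorm : A -> R;
  starD : forall x y, star (x + y) = star x + star y;
  starZ : forall (c : R[i]) x, star (c *: x) = c^* *: star x;
  starM : forall x y, star (x * y) = star y * star x;
  starK : involutive star;
  cnorm0_eq0 : forall x, cnorm x = 0 -> x = 0;
  cnormZ : forall (c : R[i]) x, cnorm (c *: x) = Normc.normc c * cnorm x;
  cnormD : forall x y, cnorm (x + y) <= cnorm x + cnorm y;
  cnormM : forall x y, cnorm (x * y) <= cnorm x * cnorm y;
  cnorm_star : forall x, cnorm (star x * x) = cnorm x ^+ 2;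
  cnorm_complete : forall a : nat -> A,
    (forall e : R, 0 < e -> exists n0, forall m n,
       (n0 <= m)%N -> (n0 <= n)%N -> cnorm (a m - a n) < e) ->
    exists l, forall e : R, 0 < e -> exists n0, forall n,
       (n0 <= n)%N -> cnorm (a n - l) < e
}.

#[short(type="cstarAlgType")]
HB.structure Definition CStarAlgebra (R : realType) :=
  {A of isCStar R A & GRing.Algebra R[i] A}.

Definition star_hom (R : realType) (A B : cstarAlgType R) (f : A -> B) : Prop :=
  [/\ forall (c : R[i]) x y, f (c *: x + y) = c *: f x + f y,
      forall x y, f (x * y) = f x * f y,
      f 1 = 1 &
      forall x, f (star x) = star (f x)].

Definition is_state (R : realType) (A : cstarAlgType R) (phi : A -> R[i]) : Prop :=
  [/\ forall (c : R[i]) x y, phi (c *: x + y) = c * phi x + phi y,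
      forall x, 0 <= phi (star x * x) &
      phi 1 = 1].

Section MinimalTensor.
Variables (R : realType) (A B : cstarAlgType R).

(* [:: (a_1, b_1); ..; (a_n, b_n)] stands for the element
   a_1 (x) b_1 + .. + a_n (x) b_n of the algebraic tensor product. *)
Definition tensor_mul (x y : seq (A * B)) : seq (A * B) :=
  [seq (p.1 * r.1, p.2 * r.2) | p <- x, r <- y].

Definition tensor_star (x : seq (A * B)) : seq (A * B) :=
  [seq (star p.1, star p.2) | p <- x].

Definition product_functional (phi : A -> R[i]) (psi : B -> R[i])
  (x : seq (A * B)) : R[i] := \sum_(p <- x) phi p.1 * psi p.2.

Definition tensor_in (T : cstarAlgType R) (i1 : A -> T) (i2 : B -> T)
  (x : seq (A * B)) : T := \sum_(p <- x) i1 p.1 * i2 p.2.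

(* T is A (x)_min B, with i1 a = a (x) 1 and i2 b = 1 (x) b.  The last clause is
   the spatial norm, computed in the GNS representations of the product states:
   ||x|| is the least c such that
   (phi (x) psi)(y^* x^* x y) <= c^2 (phi (x) psi)(y^* y) for all phi, psi, y. *)
Definition is_min_tensor (T : cstarAlgType R) (i1 : A -> T) (i2 : B -> T) : Prop :=
  [/\ star_hom i1, star_hom i2,
      forall a b, i1 a * i2 b = i2 b * i1 a,
      forall (t : T) (e : R), 0 < e ->
        exists x, cnorm (t - tensor_in i1 i2 x) < e &
      forall (x : seq (A * B)) (c : R), 0 <= c ->
        (cnorm (tensor_in i1 i2 x) <= c <->
         forall phi psi y, is_state phi -> is_state psi ->
           product_functional phi psi
             (tensor_mul (tensor_star (tensor_mul x y)) (tensor_mul x y))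
           <= (c ^+ 2)%:C%C *
              product_functional phi psi (tensor_mul (tensor_star y) y))].

End MinimalTensor.

(* The Hilbert space of a representation is C^n with its standard inner product,
   and B(C^n) (x) A is identified with 'M[A]_n. *)
Section Representations.
Variables (R : realType) (A T : cstarAlgType R).
Variables (i1 i2 : A -> T) (delta : A -> T).

Definition scalar_mx_in (m n : nat) (S : 'M[R[i]]_(m, n)) : 'M[A]_(m, n) :=
  map_mx (fun c => c%:A) S.

Definition star_mx (n : nat) (U : 'M[A]_n) : 'M[A]_n :=
  \matrix_(i, j) star (U j i).

Definition unitary_rep (n : nat) (U : 'M[A]_n) : Prop :=
  [/\ forall i j, delta (U i j) = \sum_k i1 (U i k) * i2 (U k j),
      star_mx U *m U = 1%:M &
      U *m star_mx U = 1%:M].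

Definition mor (m n : nat) (U : 'M[A]_m) (V : 'M[A]_n) (S : 'M[R[i]]_(n, m)) : Prop :=
  scalar_mx_in S *m U = V *m scalar_mx_in S.

Definition irreducible_rep (n : nat) (U : 'M[A]_n) : Prop :=
  (0 < n)%N /\ forall S, mor U U S -> exists c, S = c%:M.

(* Uc = (j (x) id)(U^-1), written in the dual basis. *)
Definition contragredient (n : nat) (U Uc : 'M[A]_n) : Prop :=
  U *m Uc^T = 1%:M /\ Uc^T *m U = 1%:M.

(* Orientation: F intertwines U^cc and U in the direction F U^cc = U F.  With the
   relations of [qunitary_relations] below one has S^2(u_ij) = q^(2(i-j)) u_ij, so
   for U = (u_ij) and N = 2 this gives F = diag(q, q^-1), the value prescribed by
   the Gelfand-Tsetlin formula q^(-(N-1)|nu| + 2 sum_n |nu^(n)|) of [gt_basis].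
   The opposite direction F U = U^cc F would give diag(q^-1, q) and contradict
   that formula. *)
Definition density_matrix (n : nat) (U : 'M[A]_n) (F : 'M[R[i]]_n) : Prop :=
  [/\ F \in unitmx,
      forall v : 'cV[R[i]]_n, 0 <= ((map_mx Num.conj v)^T *m F *m v) 0 0,
      exists Uc Ucc, [/\ contragredient U Uc, contragredient Uc Ucc & mor Ucc U F] &
      forall S, mor U U S -> \tr (F *m S) = \tr (invmx F *m S)].

End Representations.

Section QuantumUnitaryGroup.
Variables (R : realType) (q : R) (N : nat).

Definition qC : R[i] := (q%:C)%C.
Definition sqrt_qC : R[i] := ((Num.sqrt q)%:C)%C.

Definition perm_length (s : 'S_N) : nat :=
  #|[set p : 'I_N * 'I_N | (p.1 < p.2)%N && (s p.2 < s p.1)%N]|.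

Definition qdet (B : cstarAlgType R) (u : 'M[B]_N) : B :=
  \sum_(s : 'S_N) (- qC) ^+ perm_length s *: \prod_(i < N) u i (s i).

(* In the last field s is the matrix (S(u_ij)): by the antipode axiom it is the
   inverse of u. *)
Record qunitary_relations (B : cstarAlgType R) (u : 'M[B]_N) (d : B) : Prop :=
  QUnitaryRelations {
  qu_col : forall i k j : 'I_N, (i < k)%N -> u i j * u k j = qC *: (u k j * u i j);
  qu_row : forall i j l : 'I_N, (j < l)%N -> u i j * u i l = qC *: (u i l * u i j);
  qu_anti : forall i j k l : 'I_N, (i < k)%N -> (l < j)%N ->
    u i j * u k l = u k l * u i j;
  qu_diag : forall i j k l : 'I_N, (i < k)%N -> (j < l)%N ->
    u i j * u k l - qC *: (u i l * u k j) =
    u k l * u i j - qC^-1 *: (u k j * u i l);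
  qu_dcomm : forall i j, d * u i j = u i j * d;
  qu_dl : d * qdet u = 1;
  qu_dr : qdet u * d = 1;
  qu_star : exists s : 'M[B]_N,
    [/\ u *m s = 1%:M, s *m u = 1%:M & forall i j, star (u i j) = s j i]
}.

(* d plays the role of det_q^-1. *)
Definition is_quantum_unitary_group (A : cstarAlgType R) (u : 'M[A]_N) (d : A) : Prop :=
  qunitary_relations u d /\
  forall (B : cstarAlgType R) (v : 'M[B]_N) (e : B), qunitary_relations v e ->
    exists! f : A -> B, [/\ star_hom f, forall i j, f (u i j) = v i j & f d = e].

Definition is_comultiplication (A T : cstarAlgType R) (i1 i2 : A -> T)
  (u : 'M[A]_N) (delta : A -> T) : Prop :=
  star_hom delta /\ forall i j, delta (u i j) = \sum_k i1 (u i k) * i2 (u k j).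

Section Pairing.
Variables (A : cstarAlgType R) (u : 'M[A]_N) (d : A).

(* The Hopf *-algebra generated by the u_ij and det_q^-1, inside A.  It contains
   the matrix coefficients of all finite-dimensional unitary representations. *)
Inductive in_hopf : A -> Prop :=
| hopf_one : in_hopf 1
| hopf_gen i j : in_hopf (u i j)
| hopf_dinv : in_hopf d
| hopf_lin (c : R[i]) x y : in_hopf x -> in_hopf y -> in_hopf (c *: x + y)
| hopf_mul x y : in_hopf x -> in_hopf y -> in_hopf (x * y).

Definition eps (i : 'I_N) : {ffun 'I_N -> int} := [ffun j => (i == j)%:R].

(* K h is q^(h/2) = q^((h_1 eps_1 + .. + h_N eps_N)/2) and E k is the raising
   generator e_k (k + 1 < N), as functionals on the Hopf *-algebra; their values
   off [in_hopf] are irrelevant.  With a_k = eps_k - eps_(k+1),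
     Delta(q^(h/2)) = q^(h/2) (x) q^(h/2),
     Delta(e_k) = e_k (x) q^(-a_k/2) + q^(a_k/2) (x) e_k,
   and on the vector representation (u_ij) they act by diag(q^(h_i/2)) and by the
   matrix unit (k, k+1). *)
Record gl_pairing (K : {ffun 'I_N -> int} -> A -> R[i]) (E : 'I_N -> A -> R[i]) : Prop :=
  GlPairing {
  K_lin : forall h (c : R[i]) x y, in_hopf x -> in_hopf y ->
    K h (c *: x + y) = c * K h x + K h y;
  K_mul : forall h x y, in_hopf x -> in_hopf y -> K h (x * y) = K h x * K h y;
  K_one : forall h, K h 1 = 1;
  K_gen : forall h i j, K h (u i j) = (sqrt_qC ^ (h i)) *+ (i == j);
  E_lin : forall k (c : R[i]) x y, in_hopf x -> in_hopf y ->
    E k (c *: x + y) = c * E k x + E k y;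
  E_mul : forall (k k' : 'I_N) x y, k' = k.+1 :> nat -> in_hopf x -> in_hopf y ->
    E k (x * y) = E k x * K (eps k' - eps k) y + K (eps k - eps k') x * E k y;
  E_gen : forall (k k' i j : 'I_N), k' = k.+1 :> nat ->
    E k (u i j) = ((i == k) && (j == k'))%:R
}.

Variables (K : {ffun 'I_N -> int} -> A -> R[i]) (E : 'I_N -> A -> R[i]).

(* A functional X acts on the space of U by v |-> (id (x) X)(U) v. *)
Definition weight_vector (n : nat) (U : 'M[A]_n) (a : 'I_N -> int) (v : 'cV[R[i]]_n) : Prop :=
  v != 0 /\ forall i, map_mx (K (eps i)) U *m v = sqrt_qC ^ (a i) *: v.

Definition highest_weight (n : nat) (U : 'M[A]_n) (a : 'I_N -> int) : Prop :=
  (forall i j, in_hopf (U i j)) /\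
  exists2 v, weight_vector U a v &
    forall k : 'I_N, (k.+1 < N)%N -> map_mx (E k) U *m v = 0.

End Pairing.

Definition Sign := {s : N.-tuple int | sorted >=%R s}.

Definition sign_part (nu : Sign) (i : 'I_N) : int := tnth (val nu) i.

Definition sign_size (nu : Sign) : int := \sum_(i < N) sign_part nu i.

Definition interlace (m l : seq int) : Prop :=
  forall i, (i < size m)%N -> l`_i.+1 <= m`_i <= l`_i.

(* Entry n (counted from 0) of t is nu^(n+1), so that
   t = (nu^(1) < nu^(2) < .. < nu^(N) = nu). *)
Definition gt_pattern (nu : Sign) (t : N.-tuple (seq int)) : Prop :=
  [/\ forall n : 'I_N, size (tnth t n) = n.+1 /\ sorted >=%R (tnth t n),
      forall n n' : 'I_N, n' = n.+1 :> nat -> interlace (tnth t n) (tnth t n') &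
      forall n : 'I_N, n.+1 = N -> tnth t n = tval (val nu)].

(* |nu^(n)|, with |nu^(0)| = 0. *)
Definition gt_size (t : N.-tuple (seq int)) (n : nat) : int :=
  if n is m.+1 then \sum_(x <- nth [::] t m) x else 0.

Definition gt_weight (t : N.-tuple (seq int)) (i : 'I_N) : int :=
  gt_size t i.+1 - gt_size t i.

Definition gt_density (nu : Sign) (t : N.-tuple (seq int)) : R[i] :=
  qC ^ (- (N.-1)%:Z * sign_size nu + 2%:Z * \sum_(1 <= n < N) gt_size t n).

(* The columns of P are the vectors v_t, t running through the patterns gt k. *)
Definition gt_basis (A : cstarAlgType R) (K : {ffun 'I_N -> int} -> A -> R[i])
  (nu : Sign) (n : nat) (U : 'M[A]_n) (F : 'M[R[i]]_n)
  (P : 'M[R[i]]_n) (gt : 'I_n -> N.-tuple (seq int)) : Prop :=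
  [/\ P \in unitmx,
      injective gt,
      forall t, gt_pattern nu t <-> exists k, gt k = t,
      forall k, weight_vector K U (gt_weight (gt k)) (col k P) &
      forall k, F *m col k P = gt_density nu (gt k) *: col k P].

Definition torus : set 'rV[R[i]]_N := [set z | forall i, `|z 0 i| = 1].

(* piT a z is the value at z of pi_T(a) in C(T^N). *)
Definition is_torus_hom (A : cstarAlgType R) (u : 'M[A]_N) (d : A)
  (piT : A -> 'rV[R[i]]_N -> R[i]) : Prop :=
  [/\ forall a, {within (torus : set 'rV[(R[i])^o]_N),
                  continuous (piT a : 'rV[(R[i])^o]_N -> (R[i])^o)},
      forall z, torus z ->
        [/\ forall (c : R[i]) x y, piT (c *: x + y) z = c * piT x z + piT y z,
            forall x y, piT (x * y) z = piT x z * piT y z,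
            piT 1 z = 1 &
            forall x, piT (star x) z = (piT x z)^*],
      forall z i j, torus z -> piT (u i j) z = z 0 i *+ (i == j) &
      forall z, torus z -> piT d z = \prod_(i < N) (z 0 i)^-1].

(* Indices start from 0, hence j.+1 in the exponent nu_j + N - j. *)
Definition schur (nu : Sign) (x : 'rV[R[i]]_N) : R[i] :=
  \det (\matrix_(i < N, j < N) x 0 i ^ (sign_part nu j + (N - j.+1)%:Z)) /
  \prod_(i < N) \prod_(j < N | (i < j)%N) (x 0 i - x 0 j).

Definition qtwist (z : 'rV[R[i]]_N) : 'rV[R[i]]_N :=
  \row_i (qC ^- (2 * i) * z 0 i).

End QuantumUnitaryGroup.

Section Sums.
Variables (R : realType) (I : choiceType).

(* Convergence of sum_i f i along the finite subsets of I, uniformly on D. *)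
Definition has_usum (X : Type) (D : set X) (f : I -> X -> R[i]) (s : X -> R[i]) : Prop :=
  forall e : R, 0 < e -> exists A0 : {fset I}, forall A : {fset I},
    (A0 `<=` A)%fset -> forall x, D x -> `|\sum_(i <- A) f i x - s x| < (e%:C)%C.

Definition has_sum (f : I -> R[i]) (s : R[i]) : Prop :=
  has_usum [set: unit] (fun i _ => f i) (fun _ => s).

(* 0 when the family is not summable. *)
Definition csum (f : I -> R[i]) : R[i] := xget 0 [set s | has_sum f s].

End Sums.

Section Slices.
Variables (R : realType) (N : nat) (n : Sign N -> nat).

(* W*(U_q(N)) is the algebra of norm-bounded families in [blocks]; functionals on
   W*(U_q(N)) are functions on [blocks] whose values at unbounded families are
   irrelevant. *)
Definition blocks : Type := forall nu : Sign N, 'M[R[i]]_(n nu).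

(* The operator norm of a is at most c. *)
Definition opnorm_le (m : nat) (a : 'M[R[i]]_m) (c : R) : Prop :=
  0 <= c /\ forall v : 'cV[R[i]]_m,
    \sum_k `|(a *m v) k 0| ^+ 2 <= (c%:C)%C ^+ 2 * \sum_k `|v k 0| ^+ 2.

Definition in_wstar (x : blocks) : Prop := exists c, forall nu, opnorm_le (x nu) c.

Definition embed_block (nu : Sign N) (a : 'M[R[i]]_(n nu)) : blocks :=
  fun mu => match nu =P mu with
            | ReflectT e => eq_rect nu (fun rho => 'M[R[i]]_(n rho)) a mu e
            | ReflectF _ => 0
            end.

Definition component (chi : blocks -> R[i]) (nu : Sign N) (a : 'M[R[i]]_(n nu)) : R[i] :=
  chi (embed_block a).

(* chi = sum_nu phi_nu with phi_nu = component chi nu in B(H_nu)^* and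
   sum_nu ||phi_nu|| < oo. *)
Definition normal_functional (chi : blocks -> R[i]) : Prop :=
  exists c : Sign N -> R,
  [/\ forall nu, 0 <= c nu,
      (\esum_(nu in [set: Sign N]) (c nu)%:E < +oo)%E,
      forall nu (l : R[i]) (a b : 'M[R[i]]_(n nu)),
        component chi (l *: a + b) = l * component chi a + component chi b,
      forall nu (a : 'M[R[i]]_(n nu)) (r : R),
        opnorm_le a r -> `|component chi a| <= ((c nu * r)%:C)%C &
      forall x, in_wstar x -> has_sum (fun nu => component chi (x nu)) (chi x)].

Definition state_functional (chi : blocks -> R[i]) : Prop :=
  chi (fun nu => 1%:M) = 1 /\
  forall x, in_wstar x -> 0 <= chi (fun nu => (map_mx Num.conj (x nu))^T *m x nu).

Definition chi_sign (F : blocks) (nu : Sign N) : blocks -> R[i] :=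
  fun x => \tr (F nu *m x nu) / \tr (F nu).

Definition chi_mix (F : blocks) (P : Sign N -> R) : blocks -> R[i] :=
  fun x => csum (fun nu => ((P nu)%:C)%C * chi_sign F nu x).

Variables (A : cstarAlgType R) (U : forall nu, 'M[A]_(n nu)).
Variable piT : A -> 'rV[R[i]]_N -> R[i].

(* (phi_nu (x) pi_T)(U_nu)(z) for phi_nu = component chi nu. *)
Definition slice_term (chi : blocks -> R[i]) (nu : Sign N) (z : 'rV[R[i]]_N) : R[i] :=
  \sum_i \sum_j component chi (delta_mx i j : 'M[R[i]]_(n nu)) * piT (U nu i j) z.

(* (chi (x) pi_T)(V_N)(z) *)
Definition slice (chi : blocks -> R[i]) (z : 'rV[R[i]]_N) : R[i] :=
  csum (fun nu => slice_term chi nu z).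

End Slices.

Definition is_probability (R : realType) (N : nat) (P : Sign N -> R) : Prop :=
  (forall nu, 0 <= P nu) /\ (\esum_(nu in [set: Sign N]) (P nu)%:E = 1)%E.

Definition generating_function (R : realType) (q : R) (N : nat) (P : Sign N -> R)
  (x : 'rV[R[i]]_N) : R[i] :=
  csum (fun nu => ((P nu)%:C)%C * (schur nu x / schur nu (qtwist q (const_mx 1)))).

(* Main.v *)
Require Import Defs.
From HB Require Import structures.
From mathcomp Require Import all_boot all_order all_fingroup all_algebra.
From mathcomp Require Import finmap.
From mathcomp Require Import all_classical all_reals all_analysis.
From mathcomp Require Import complex.
From mathcomp Require Import zify ring lra.
Set Implicit Arguments.
Unset Strict Implicit.
Unset Printing Implicit Defensive.
Import Order.TTheory GRing.Theory Num.Theory numFieldNormedType.Exports.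
Local Open Scope ring_scope.

(* On the torus, z |-> M(z) = (id (x) pi_T)(U_nu)(z) is multiplicative: the
   restrictions to points of the torus are characters of A, hence states, so
   their products make sense on the minimal tensor product.  Along each coordinate
   axis M is a Laurent polynomial, and its value at sqrt q is the action of
   q^(eps_i/2); multiplicativity propagates the eigenvector equation from sqrt q
   to all its powers, hence everywhere, and M(z) is diagonal in the Gelfand-Tsetlin
   basis with entries z^weight.  Thus Tr(F_nu M(z)) is a sum over Gelfand-Tsetlin
   patterns, which the branching rule identifies with
   q^((N-1)|nu|) s_nu(z_1, q^-2 z_2, .., q^(-2(N-1)) z_N).  Mixtures converge
   uniformly because |Tr(F x)| <= Tr(F) ||x|| for a positive matrix F. *)

(** * Gelfand-Tsetlin patterns and Schur polynomials *)

(** [delta] takes values in the completed algebra [T], while tensors are plain lists of pairs, so a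
    product functional is never constructed on [T]: it suffices that its value on a list depends
    only on the image of the list in [T]. The spatial norm yields this for states, hence at points
    of the torus; [K h] is controlled only on the Hopf algebra and through no positivity. This is
    the obstacle behind the polynomials: the pairing gives an eigenvector at the single point sqrt
    q, off the unit circle, whereas multiplicativity is known on the circle only. A polynomial is
    determined by its values on the circle and equally by its values at the powers of sqrt q, which
    joins the two. The comultiplication is prescribed on the u_ij but not on det_q^-1. Identities on
    the Hopf algebra are therefore proved up to a power of the quantum determinant, which is central
    and has modulus 1 on the torus. The factor q^((N-1)|nu|) is what the density exponent leaves
    over once the substitution z_i -> q^(-2(i-1)) z_i is accounted for; it depends on |nu| alone and
    cancels against Tr(F_nu). *)

Fixpoint list_prod (T : Type) (S : seq (seq T)) : seq (seq T) :=
  if S is s :: S' then [seq k :: m | k <- s, m <- list_prod S'] else [:: [::]].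

Lemma mem_list_prod (T : eqType) (x0 : T) (S : seq (seq T)) (m : seq T) :
  (m \in list_prod S) <->
  size m = size S /\ forall i, (i < size S)%N -> nth x0 m i \in nth [::] S i.
Proof.
elim: S m => [|s S IH] m /=.
  rewrite inE; split=> [/eqP-> //|[/size0nil-> _]]; exact: eqxx.
split.
  case/allpairsP => -[k m'] /= [ks /IH [sm mS] ->] /=; split; first by rewrite sm.
  by case=> [|i] //= /mS.
case: m => [|k m] [] //= [sm] H; apply/allpairsP; exists (k, m); split=> //=.
  exact: (H 0%N).
by apply/IH; split=> // i iS; apply: (H i.+1).
Qed.

Lemma uniq_list_prod (T : eqType) (S : seq (seq T)) :
  all uniq S -> uniq (list_prod S).
Proof.
elim: S => //= s S IH /andP[us /IH uS]; apply: allpairs_uniq => //.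
by move=> [k m] [k' m'] _ _ /= [-> ->].
Qed.

Lemma sum_list_prod (T : Type) (x0 : T) (C : comPzRingType) (S : seq (seq T))
    (g : nat -> T -> C) :
  \sum_(m <- list_prod S) \prod_(j < size S) g j (nth x0 m j) =
  \prod_(j < size S) \sum_(k <- nth [::] S j) g j k.
Proof.
elim: S g => [|s S IH] g /=; first by rewrite big_seq1 !big_ord0.
rewrite big_ord_recl -(IH (fun j => g j.+1)) big_allpairs_dep mulr_suml /=.
apply: eq_bigr => k _; rewrite mulr_sumr; apply: eq_bigr => m _.
by rewrite big_ord_recl.
Qed.

Lemma det_colE (C : comPzRingType) n (B : 'M[C]_n) :
  \det B = \sum_(s : 'S_n) (-1) ^+ s * \prod_j B (s j) j.
Proof.
rewrite -det_tr; apply: eq_bigr => s _; congr (_ * _).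
by apply: eq_bigr => j _; rewrite mxE.
Qed.

(** Multilinearity in the columns: each column is a sum over its own index list, so expanding all of
    them leaves one determinant per choice of summands. *)
Lemma det_sum_columns (T : Type) (x0 : T) (C : comPzRingType) n
    (S : seq (seq T)) (f : 'I_n -> nat -> T -> C) : size S = n ->
  \det (\matrix_(i < n, j < n) \sum_(k <- nth [::] S j) f i j k) =
  \sum_(m <- list_prod S) \det (\matrix_(i < n, j < n) f i j (nth x0 m j)).
Proof.
move=> sS; rewrite -sS in f *.
under [RHS]eq_bigr do rewrite det_colE.
rewrite exchange_big det_colE; apply: eq_bigr => /= s _; rewrite -mulr_sumr.
congr (_ * _); under eq_bigr do rewrite mxE.
(* [sum_list_prod] wants a family indexed by [nat], while [f (s j)] needs an ordinal; [insub]
   converts, and its default 0 is never reached. *)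
transitivity (\prod_(j < size S) \sum_(k <- nth [::] S j)
    (if insub (j : nat) is Some j' then f (s j') j k else 0)).
  by apply: eq_bigr => j _; apply: eq_bigr => k _; rewrite valK.
rewrite -(sum_list_prod x0 S
  (fun j k => if insub j is Some j' then f (s j') j k else 0)).
by apply: eq_bigr => m _; apply: eq_bigr => j _; rewrite mxE valK.
Qed.

Definition int_range (a b : int) : seq int :=
  [seq a + i%:Z | i <- iota 0 (`|b - a|%N).+1].

Lemma mem_int_range (a b k : int) :
  a <= b -> (k \in int_range a b) = (a <= k <= b).
Proof.
move=> ab; apply/mapP/idP => [[m]|/andP[ak kb]].
  by rewrite mem_iota => /andP[_ mb] ->; lia.
by exists `|k - a|%N; [rewrite mem_iota; lia|lia].
Qed.

Lemma uniq_int_range (a b : int) : uniq (int_range a b).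
Proof. by rewrite map_inj_uniq ?iota_uniq // => i j; lia. Qed.

(** The interlacing conditions on the entries of the lower row are independent of each other, so the
    admissible rows form a product of intervals. This is the shape in which multilinearity of the
    determinant produces them. *)
Definition interlaced_below (l : seq int) : seq (seq int) :=
  list_prod [seq int_range l`_j.+1 l`_j | j <- iota 0 (size l).-1].

(** The numerator of the Schur polynomial. Variables are indexed by [nat] so that the same [x]
    serves every [n] in the inductions. *)
Definition partition_det (C : fieldType) n (l : seq int) (x : nat -> C) : C :=
  \det (\matrix_(i < n, j < n) x i ^ (l`_j + (n - j.+1)%:Z)).

(** The factorization of x^(d+1) - y^(d+1) with d = b - a, multiplied by x^(a+c). *)
Lemma geometric_range (C : fieldType) (a b c : int) (x y : C) :
  a <= b -> x != 0 -> y != 0 ->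
  (x - y) * \sum_(k <- int_range a b) x ^ (k + c) * y ^ (b - k) =
  x ^ (b + c + 1) - y ^ (b - a + 1) * x ^ (a + c).
Proof.
move=> ab x0 y0; set d := `|b - a|%N.
have bE : b = a + d%:Z by rewrite /d; lia.
rewrite /int_range -/d big_map.
have -> : x ^ (b + c + 1) - y ^ (b - a + 1) * x ^ (a + c) =
          x ^ (a + c) * (x ^+ d.+1 - y ^+ d.+1).
  rewrite mulrBr !exprnP -expfzDr // [x ^ _ * y ^ _]mulrC.
  by congr (x ^ _ - y ^ _ * _); lia.
rewrite subrXX mulrCA -[iota _ _]/(index_iota 0 d.+1) big_mkord.
congr (_ * _); rewrite mulr_sumr (reindex_inj rev_ord_inj).
apply: eq_bigr => i _; have := ltn_ord i; rewrite /= subSS !exprnP mulrA => id_.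
by rewrite -expfzDr //; congr (x ^ _ * y ^ _); lia.
Qed.

(** The branching rule for numerators. After column reduction only one minor survives; its row i is
    divisible by x_i - x_n, and the quotient in column j is a geometric sum over the interval
    allowed for m_j by interlacing. *)
Lemma partition_det_branch (C : fieldType) n (l : seq int) (x : nat -> C) :
    size l = n.+1 -> (forall j, (j < n)%N -> l`_j.+1 <= l`_j) ->
    (forall i, (i <= n)%N -> x i != 0) ->
  partition_det n.+1 l x =
  \prod_(i < n) (x i - x n) *
  \sum_(m <- interlaced_below l)
     partition_det n m x * x n ^ (\sum_(j < n.+1) l`_j - \sum_(j < n) m`_j).
Proof.
move=> sl sort_l x0; set y := x n.
have y0 : y != 0 by apply: x0.
pose e (j : nat) : int := l`_j + (n.+1 - j.+1)%:Z.
(* Multiplying by B subtracts y^(e_j - e_(j+1)) times column j+1 from column j,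
   which clears the last row up to its last entry. *)
pose B : 'M[C]_n.+1 := \matrix_(k, j)
  ((k == j)%:R - y ^ (e j - e j.+1) *+ (k == j.+1 :> nat)).
pose X : 'M[C]_n.+1 := \matrix_(i, j) x i ^ e j.
have detB : \det B = 1.
  rewrite det_trig.
    by apply: big1 => i _; rewrite mxE eqxx ltn_eqF ?subr0.
  apply/is_trig_mxP => i j ij; rewrite mxE.
  by rewrite -val_eqE /= !ltn_eqF ?subr0 // ltnW.
have XBE (i j : 'I_n.+1) : (X *m B) i j =
    x i ^ e j - (y ^ (e j - e j.+1) * x i ^ e j.+1) *+ (j < n)%N.
  rewrite mxE; under eq_bigr do rewrite !mxE mulrBr.
  rewrite sumrB; congr (_ - _).
    by rewrite (bigD1 j) //= eqxx mulr1 big1 ?addr0 // => k /negbTE->; rewrite mulr0.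
  case: ltnP => jn; last first.
    rewrite big1 // => k _; rewrite ltn_eqF ?mulr0n ?mulr0 //.
    by rewrite (leq_trans (ltn_ord k)).
  have jn' : (j.+1 < n.+1)%N by [].
  rewrite (bigD1 (Ordinal jn')) //= eqxx mulr1n big1 ?addr0; first by rewrite mulrC.
  by move=> k; rewrite -val_eqE /= => /negbTE->; rewrite mulr0n mulr0.
have -> : partition_det n.+1 l x = \det (X *m B) by rewrite det_mulmx detB mulr1.
rewrite (expand_det_row _ ord_max) big_ord_recr /= big1 ?add0r; last first.
  move=> j _; rewrite XBE /= ltn_ord -/y -expfzDr //.
  by rewrite subrK subrr mul0r.
rewrite XBE /= ltnn subr0 /cofactor /= -signr_odd oddD addbb expr0 mul1r.
(* Entry (i, j) of the minor is [geometric_range] with a = l_(j+1), b = l_j and c = n - j - 1: then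
   b + c + 1 = e_j and a + c = e_(j+1). *)
pose G := \matrix_(i < n, j < n) \sum_(k <- int_range l`_j.+1 l`_j)
   (x i ^ (k + (n - j.+1)%:Z) * y ^ (l`_j - k)).
have -> : row' ord_max (col' ord_max (X *m B)) =
          diag_mx (\row_(i < n) (x i - y)) *m G.
  apply/matrixP => /= i j; rewrite mul_diag_mx !mxE.
  have := XBE (lift ord_max i) (lift ord_max j); rewrite mxE => ->.
  rewrite !lift_max ltn_ord geometric_range ?sort_l //; last first.
    by rewrite x0 // ltnW.
  have jn := ltn_ord j.
  by congr (_ ^ _ - (y ^ _ * _ ^ _)); rewrite /e; lia.
rewrite det_mulmx det_diag mulrCA; congr (_ * _).
  by apply: eq_bigr => i _; rewrite mxE.
have sS : size [seq int_range l`_j.+1 l`_j | j <- iota 0 (size l).-1] = n.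
  by rewrite size_map size_iota sl.
pose f (i : 'I_n) (j : nat) (k : int) := x i ^ (k + (n - j.+1)%:Z) * y ^ (l`_j - k).
have -> : G = \matrix_(i < n, j < n)
   \sum_(k <- nth [::] [seq int_range l`_j.+1 l`_j | j <- iota 0 (size l).-1] j) f i j k.
  apply/matrixP => i j; rewrite !mxE (nth_map 0%N) ?size_iota ?sl //.
  by rewrite nth_iota.
rewrite (det_sum_columns 0) // mulr_sumr; apply: eq_bigr => m _.
rewrite /f; have -> : \matrix_(i < n, j < n)
      (x i ^ (m`_j + (n - j.+1)%:Z) * y ^ (l`_j - m`_j)) =
    (\matrix_(i < n, j < n) x i ^ (m`_j + (n - j.+1)%:Z)) *m
      diag_mx (\row_(j < n) y ^ (l`_j - m`_j)).
  by apply/matrixP => i j; rewrite mul_mx_diag !mxE.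
rewrite det_mulmx det_diag mulrCA; congr (_ * _).
have -> : \prod_(i < n) (\row_(j < n) y ^ (l`_j - m`_j)) 0 i =
          y ^ (\sum_(j < n) (l`_j - m`_j)).
  under eq_bigr do rewrite mxE.
  by apply: (big_ind2 (fun (a : C) (b : int) => a = y ^ b)) => // a a' b b' -> ->; rewrite expfzDr.
rewrite -expfzDr // big_ord_recr /= sumrB; congr (_ ^ _).
by rewrite /e subnn addr0 addrA [l`_n + _]addrC.
Qed.

Lemma mem_interlaced_below (l m : seq int) :
    (forall j, (j < (size l).-1)%N -> l`_j.+1 <= l`_j) ->
  (m \in interlaced_below l) <-> size m = (size l).-1 /\ interlace m l.
Proof.
move=> sort_l; rewrite (mem_list_prod 0) size_map size_iota.
split=> -[sm H]; split=> // i ik.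
  rewrite sm in ik; have := H i ik; rewrite (nth_map 0%N) ?size_iota // nth_iota //.
  by rewrite mem_int_range ?sort_l.
rewrite (nth_map 0%N) ?size_iota // nth_iota //.
by rewrite mem_int_range ?sort_l // H // sm.
Qed.

Lemma uniq_interlaced_below (l : seq int) : uniq (interlaced_below l).
Proof.
by apply: uniq_list_prod; apply/allP => s /mapP[j _ ->]; apply: uniq_int_range.
Qed.

Lemma size_interlaced_below (l m : seq int) :
  m \in interlaced_below l -> size m = (size l).-1.
Proof. by move/(mem_list_prod 0) => [-> _]; rewrite size_map size_iota. Qed.

(** Rows are stored from the shortest to the longest, as in [gt_pattern]; the recursion peels off
    the top row, hence [rcons]. *)
Fixpoint gt_patterns (n : nat) (l : seq int) : seq (seq (seq int)) :=
  if n is n'.+1 then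
    [seq rcons t l | m <- interlaced_below l, t <- gt_patterns n' m]
  else [:: [::]].

(** [gt_size] for a bare list of rows, whose length may vary in inductions. *)
Definition level_size (t : seq (seq int)) (n : nat) : int :=
  if n is m.+1 then \sum_(x <- nth [::] t m) x else 0.

Lemma size_gt_patterns n l t : t \in gt_patterns n l -> size t = n.
Proof.
elim: n l t => [|n IH] l t /=; first by rewrite inE => /eqP->.
by case/allpairsPdep => m [s [_ /IH ss ->]]; rewrite size_rcons ss.
Qed.

Lemma last_gt_patterns n l t :
  t \in gt_patterns n l -> (0 < n)%N -> nth [::] t n.-1 = l.
Proof.
case: n => //= n /allpairsPdep [m [s [_ /size_gt_patterns ss ->]]] _.
by rewrite nth_rcons ss ltnn eqxx.
Qed.

Lemma uniq_gt_patterns n l : size l = n -> uniq (gt_patterns n l).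
Proof.
elim: n l => //= n IH l sl; apply: allpairs_uniq_dep.
- exact: uniq_interlaced_below.
- by move=> m /size_interlaced_below sm; apply: IH; rewrite sm sl.
have mem_tagged (w : {m : seq int & seq (seq int)}) :
    w \in [seq existT (fun=> seq (seq int)) m t | m <- interlaced_below l,
           t <- gt_patterns n m] ->
    tag w \in interlaced_below l /\ tagged w \in gt_patterns n (tag w).
  by case/allpairsPdep => m [t [mi ti ->]].
move=> [m t] [m' t'] /mem_tagged[/= mi ti] /mem_tagged[/= mi' ti'] /rcons_inj[ett].
rewrite -{t'}ett in ti' *; suff -> : m = m' by [].
(* The row [m] is recovered as the last row of [t]; when there is no such row, [m] and [m'] are both
   empty. *)
case: n {IH mem_tagged} sl ti ti' => [|n] sl ti ti'.
  move: (size_interlaced_below mi) (size_interlaced_below mi').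
  by rewrite sl => /size0nil-> /size0nil->.
by rewrite -(last_gt_patterns ti) // -(last_gt_patterns ti').
Qed.

Definition vandermonde_prod (C : fieldType) n (x : nat -> C) : C :=
  \prod_(i < n) \prod_(j < n | (i < j)%N) (x i - x j).

Lemma vandermonde_prodS (C : fieldType) n (x : nat -> C) :
  vandermonde_prod n.+1 x = vandermonde_prod n x * \prod_(i < n) (x i - x n).
Proof.
rewrite /vandermonde_prod big_ord_recr /= [X in _ * X]big1 ?mulr1; last first.
  by move=> j; rewrite ltnNge -ltnS ltn_ord.
rewrite -big_split; apply: eq_bigr => i _ /=.
by rewrite big_mkcond big_ord_recr /= ltn_ord -big_mkcond.
Qed.

Lemma level_size_rcons t l i : (i <= size t)%N ->
  level_size (rcons t l) i = level_size t i.
Proof. by case: i => //= i it; rewrite nth_rcons it. Qed.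

(** Iterated branching: each row contributes a power of one variable, and the products of
    differences accumulate to the Vandermonde product. Stated before division, so coinciding
    variables are allowed. *)
Lemma partition_det_gt_patterns (C : fieldType) n (l : seq int) (x : nat -> C) :
    size l = n -> sorted >=%R l -> (forall i, (i < n)%N -> x i != 0) ->
  partition_det n l x = vandermonde_prod n x *
    \sum_(t <- gt_patterns n l)
      \prod_(i < n) x i ^ (level_size t i.+1 - level_size t i).
Proof.
elim: n l => [|n IH] l sl sort_l x0.
  by rewrite /partition_det det_mx00 /vandermonde_prod big_ord0 big_seq1 big_ord0 mulr1.
have nth_l j : (j < n)%N -> l`_j.+1 <= l`_j.
  by move=> jn; apply: (sortedP 0 sort_l); rewrite sl.
rewrite partition_det_branch // vandermonde_prodS mulrAC mulrC; congr (_ * _).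
rewrite /= big_allpairs_dep mulr_sumr /=; apply: eq_big_seq => m mi.
have sm : size m = n by rewrite (size_interlaced_below mi) sl.
have [_ im] : size m = (size l).-1 /\ interlace m l.
  by apply/mem_interlaced_below => //; rewrite sl.
have sort_m : sorted >=%R m.
  apply/(sortedP 0) => j jm.
  have /andP[+ _] := im j (ltnW jm); have /andP[_] := im j.+1 jm; exact: le_trans.
rewrite IH //; last by move=> i /ltnW; apply: x0.
rewrite -mulrA mulr_suml; congr (_ * _); apply: eq_big_seq => t tm.
have st := size_gt_patterns tm.
rewrite [RHS]big_ord_recr /= nth_rcons st ltnn eqxx level_size_rcons ?st //; congr (_ * _).
  apply: eq_bigr => i _; rewrite -/(level_size _ i.+1).
  rewrite level_size_rcons ?st ?(ltnW (ltn_ord i)) //.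
  by rewrite nth_rcons st ltn_ord.
rewrite [X in _ = _ ^ (X - _)](big_nth 0) sl big_mkord; congr (_ ^ (_ - _)) => //.
(* For [n = 0] both sides vanish: level 0 has size 0 by convention and the sum over [m] is empty. *)
case: n {IH x0 nth_l} sl sm tm st => [|n] sl sm tm st /=; first by rewrite big_ord0.
by rewrite (last_gt_patterns tm) // [RHS](big_nth 0) sm big_mkord.
Qed.

Lemma mem_gt_patterns n (l : seq int) (t : seq (seq int)) :
    size l = n -> sorted >=%R l ->
  t \in gt_patterns n l <->
  [/\ size t = n,
      forall i, (i < n)%N -> size (nth [::] t i) = i.+1 /\ sorted >=%R (nth [::] t i),
      forall i, (i.+1 < n)%N -> interlace (nth [::] t i) (nth [::] t i.+1) &
      (0 < n)%N -> nth [::] t n.-1 = l].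
Proof.
elim: n l t => [|n IH] l t sl sort_l.
  rewrite /= inE; split=> [/eqP->|[/size0nil->]] //.
have nth_l j : (j < n)%N -> l`_j.+1 <= l`_j.
  by move=> jn; apply: (sortedP 0 sort_l); rewrite sl.
have memP m : m \in interlaced_below l <-> size m = n /\ interlace m l.
  by have := @mem_interlaced_below l m; rewrite sl; apply.
have sorted_below m : interlace m l -> sorted >=%R m.
  move=> im; apply/(sortedP 0) => j jm.
  by have /andP[+ _] := im j (ltnW jm); have /andP[_] := im j.+1 jm; exact: le_trans.
split.
  case/allpairsPdep => m [s [/memP[sm im] /[dup] sP /IH []]] //; first exact: sorted_below.
  move=> ss Hs Hi Hl ->; split.
  - by rewrite size_rcons ss.
  - move=> i; rewrite ltnS leq_eqVlt => /predU1P[->|i_n]; rewrite nth_rcons ss.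
      by rewrite ltnn eqxx.
    by rewrite i_n; apply: Hs.
  - move=> i i_n; have i_n0 : (i < n)%N by []; rewrite !nth_rcons ss i_n0.
    move: i_n; rewrite ltnS leq_eqVlt => /predU1P[e|i_n]; last by rewrite i_n; apply: Hi.
    rewrite e ltnn eqxx; have := Hl; rewrite -e /= => -> //.
  - by move=> _; rewrite nth_rcons ss ltnn eqxx.
case=> st Hs Hi /(_ isT) /= Hl.
case/lastP: t st Hs Hi Hl => // s l' /[!size_rcons] -[ss] Hs Hi.
rewrite nth_rcons ss ltnn eqxx => e; rewrite {l'}e in Hs Hi *.
have nth_s i : (i < n)%N -> nth [::] (rcons s l) i = nth [::] s i.
  by move=> i_n; rewrite nth_rcons ss i_n.
(* The witness is the row below [l]; for [n = 0] the default [[::]] is the empty row that is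
   wanted. *)
apply/allpairsPdep; exists (last [::] s), s.
have [n0|n_gt0] := posnP n.
  move: ss; rewrite n0 => /size0nil-> /=; rewrite inE; split=> //.
  by apply/memP; rewrite n0.
have lastE : last [::] s = nth [::] s n.-1 by rewrite -nth_last ss.
have sl' : size (last [::] s) = n.
  by have [] := Hs n.-1; rewrite ?nth_s -?lastE ?prednK // ltnS ?leq_pred.
have il : interlace (last [::] s) l.
  have := Hi n.-1; rewrite prednK // nth_s ?prednK // -lastE => /(_ (leqnn _)).
  by rewrite nth_rcons ss ltnn eqxx.
split=> //; first exact/memP.
apply/IH => //; first exact: sorted_below.
split=> //.
- by move=> i i_n; have := Hs i (ltnW i_n); rewrite nth_s.
- by move=> i i_n; have := Hi i (ltnW i_n); rewrite !nth_s // ltnW.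
Qed.

(** * Multiplicativity on the torus *)

Section TensorAlgebra.
Variables (R : realType) (A T : cstarAlgType R) (i1 i2 : A -> T).
Implicit Types (x y : seq (A * A)) (phi psi : A -> R[i]).

Definition tensor_scale (c : R[i]) x : seq (A * A) := [seq (c *: p.1, p.2) | p <- x].

Lemma tensor_inD x y : tensor_in i1 i2 (x ++ y) = tensor_in i1 i2 x + tensor_in i1 i2 y.
Proof. by rewrite /tensor_in big_cat. Qed.

Lemma product_functionalD phi psi x y :
  product_functional phi psi (x ++ y) =
  product_functional phi psi x + product_functional phi psi y.
Proof. by rewrite /product_functional big_cat. Qed.

Hypotheses (i1_hom : star_hom i1) (i2_hom : star_hom i2).
Hypothesis i12_comm : forall a b, i1 a * i2 b = i2 b * i1 a.

Lemma star_homZ (B : cstarAlgType R) (f : A -> B) c a :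
  star_hom f -> f (c *: a) = c *: f a.
Proof.
case=> lin _ _ _; have f0 : f 0 = 0.
  have := lin (-1) 0 0; rewrite scaler0 addr0 scaleN1r addNr; exact.
by rewrite -[c *: a]addr0 lin f0 addr0.
Qed.

Lemma tensor_inZ c x : tensor_in i1 i2 (tensor_scale c x) = c *: tensor_in i1 i2 x.
Proof.
rewrite /tensor_in big_map scaler_sumr; apply: eq_bigr => p _ /=.
by rewrite star_homZ // scalerAl.
Qed.

Lemma tensor_inM x y :
  tensor_in i1 i2 (tensor_mul x y) = tensor_in i1 i2 x * tensor_in i1 i2 y.
Proof.
case: i1_hom i2_hom => _ i1M _ _ [_ i2M _ _].
rewrite /tensor_in big_allpairs_dep mulr_suml; apply: eq_bigr => p _.
rewrite mulr_sumr; apply: eq_bigr => r _ /=.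
by rewrite i1M i2M -!mulrA; congr (_ * _); rewrite !mulrA i12_comm.
Qed.

Lemma product_functionalM phi psi x y :
    {morph phi : a b / a * b} -> {morph psi : a b / a * b} ->
  product_functional phi psi (tensor_mul x y) =
  product_functional phi psi x * product_functional phi psi y.
Proof.
move=> phiM psiM; rewrite /product_functional big_allpairs_dep mulr_suml.
apply: eq_bigr => p _; rewrite mulr_sumr; apply: eq_bigr => r _ /=.
by rewrite phiM psiM mulrACA.
Qed.

Lemma product_functional_star phi psi x :
    (forall a, phi (star a) = (phi a)^*) -> (forall a, psi (star a) = (psi a)^*) ->
  product_functional phi psi (tensor_star x) = (product_functional phi psi x)^*.
Proof.
move=> phiS psiS; rewrite /product_functional big_map rmorph_sum.
by apply: eq_bigr => p _ /=; rewrite phiS psiS rmorphM.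
Qed.

End TensorAlgebra.

Definition star_character (R : realType) (A : cstarAlgType R) (phi : A -> R[i]) : Prop :=
  [/\ forall (c : R[i]) x y, phi (c *: x + y) = c * phi x + phi y,
      {morph phi : x y / x * y}, phi 1 = 1 & forall x, phi (star x) = (phi x)^*].

Lemma cnorm0 (R : realType) (A : cstarAlgType R) : cnorm (0 : A) = 0.
Proof.
by rewrite -[0](scale0r 0) cnormZ /Normc.normc /= expr0n addr0 sqrtr0 mul0r.
Qed.

Section StarCharacters.
Variables (R : realType) (A : cstarAlgType R).
Implicit Type phi : A -> R[i].

Lemma star_character_state phi : star_character phi -> is_state phi.
Proof.
by case=> lin mul one st; split=> // x; rewrite mul st mulrC mul_conjC_ge0.
Qed.

Variables (T : cstarAlgType R) (i1 i2 : A -> T).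
Hypothesis T_min : is_min_tensor i1 i2.

(* Star characters are states, and their product is multiplicative, so the
   spatial norm dominates it: it factors through the image of the algebraic
   tensor product. *)
Lemma product_character_eq0 phi psi (x : seq (A * A)) :
    star_character phi -> star_character psi -> tensor_in i1 i2 x = 0 ->
  product_functional phi psi x = 0.
Proof.
move=> chi_phi chi_psi x0; case: T_min => _ _ _ _ /(_ x 0 (lexx _)) [H _].
(* With c = 0 and the test element 1 (x) 1, the norm criterion reads |(phi (x) psi)(x)|^2 <= 0. *)
have := H _ phi psi [:: (1, 1)] (star_character_state chi_phi)
  (star_character_state chi_psi).
rewrite x0 cnorm0 lexx => /(_ isT).
case: chi_phi chi_psi => lphi mphi ophi sphi [lpsi mpsi opsi spsi].
rewrite !(product_functionalM, product_functional_star) // expr0n mul0r.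
rewrite {2 4}/product_functional !big_seq1 /= ophi opsi !mulr1 mulrC => le0.
by apply/eqP; rewrite -normr_eq0 -sqrf_eq0 normCK eq_le le0 mul_conjC_ge0.
Qed.

Lemma product_character_eq phi psi (x y : seq (A * A)) :
    star_character phi -> star_character psi ->
    tensor_in i1 i2 x = tensor_in i1 i2 y ->
  product_functional phi psi x = product_functional phi psi y.
Proof.
move=> chi_phi chi_psi xy; case: (T_min) => h1 h2 _ _ _.
have := @product_character_eq0 phi psi (tensor_scale (-1) y ++ x) chi_phi chi_psi.
rewrite tensor_inD tensor_inZ // xy scaleN1r addNr => /(_ erefl).
rewrite product_functionalD => /eqP; rewrite addrC addr_eq0 => /eqP ->.
rewrite /product_functional big_map -sumrN; apply: eq_bigr => p _ /=.
case: chi_phi => lin _ _ _; have phi0 : phi 0 = 0.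
  by have := lin (-1) 0 0; rewrite scaler0 addr0 mulN1r addNr; apply.
by rewrite -[-1 *: _]addr0 lin phi0 addr0 mulN1r mulNr opprK.
Qed.

End StarCharacters.

Section HopfAlgebra.
Variables (R : realType) (q : R) (N : nat) (A : cstarAlgType R).
Variables (u : 'M[A]_N) (d : A).
Hypothesis rel : qunitary_relations q u d.
Local Notation hopf := (in_hopf u d).
Local Notation D := (qdet q u).

Lemma in_hopf0 : hopf 0.
Proof.
by rewrite -(addNr 1) -scaleN1r; apply: hopf_lin; apply: hopf_one.
Qed.

Lemma in_hopfZ (c : R[i]) x : hopf x -> hopf (c *: x).
Proof. by move=> hx; rewrite -[_ *: _]addr0; apply: hopf_lin => //; apply: in_hopf0. Qed.

Lemma in_hopfD x y : hopf x -> hopf y -> hopf (x + y).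
Proof. by move=> hx hy; rewrite -[x]scale1r; apply: hopf_lin. Qed.

Lemma in_hopf_prod_gen (s : 'S_N) : hopf (\prod_i u i (s i)).
Proof.
apply: (big_ind hopf) => [|x y|i _];
  [exact: hopf_one | exact: hopf_mul | exact: hopf_gen].
Qed.

Lemma in_hopf_qdet : hopf D.
Proof.
apply: (big_ind hopf) => [|x y|s _]; [exact: in_hopf0 | exact: in_hopfD |].
by apply/in_hopfZ/in_hopf_prod_gen.
Qed.


(** A formal consequence of the centrality of [d] and of [D] being its two-sided inverse; no
    computation with the quadratic relations is involved. *)
Lemma qdet_central x : hopf x -> D * x = x * D.
Proof.
elim=> {x} [|i j||c x y _ Dx _ Dy|x y _ Dx _ Dy].
- by rewrite mulr1 mul1r.
- have du := qu_dcomm rel i j; have dD := qu_dl rel; have Dd := qu_dr rel.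
  by rewrite -[u i j * D]mul1r -Dd -!mulrA [d * (_ * D)]mulrA du -!mulrA dD mulr1.
- by rewrite (qu_dl rel) (qu_dr rel).
- by rewrite mulrDr mulrDl -scalerAl -scalerAr Dx Dy.
- by rewrite mulrA Dx -mulrA Dy mulrA.
Qed.

Lemma qdetX_central x m : hopf x -> D ^+ m * x = x * D ^+ m.
Proof.
move=> hx; elim: m => [|m IH]; first by rewrite mulr1 mul1r.
by rewrite exprSr -mulrA qdet_central // mulrA IH -mulrA.
Qed.

(** The structure shared by evaluation at a torus point and by [K h]; [gl_pairing] provides no
    compatibility of [K h] with the star. *)
Definition hopf_character (chi : A -> R[i]) : Prop :=
  [/\ forall (c : R[i]) x y, hopf x -> hopf y -> chi (c *: x + y) = c * chi x + chi y,
      forall x y, hopf x -> hopf y -> chi (x * y) = chi x * chi y &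
      chi 1 = 1].

Lemma perm_length1 : @perm_length N 1%g = 0%N.
Proof.
apply: eq_card0 => -[i j]; apply/negP; rewrite in_setE /= !perm1.
by case: (ltngtP i j).
Qed.

(** On a diagonal matrix only the identity permutation contributes, with coefficient (-q)^0. *)
Lemma hopf_character_qdet (chi : A -> R[i]) (t : 'I_N -> R[i]) :
    hopf_character chi -> (forall i j, chi (u i j) = t i *+ (i == j)) ->
  chi D = \prod_i t i.
Proof.
case=> lin mul one chi_u.
have chi0 : chi 0 = 0.
  have := lin (-1) 1 1 (hopf_one _ _) (hopf_one _ _).
  by rewrite scaleN1r mulN1r !addNr.
have chi_prod (s : 'S_N) : chi (\prod_i u i (s i)) = \prod_i chi (u i (s i)).
  (* Membership in the Hopf algebra is carried through the induction, because [chi] is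
     multiplicative only there. *)
  suff [] : chi (\prod_i u i (s i)) = \prod_i chi (u i (s i)) /\
            hopf (\prod_i u i (s i)) by [].
  elim/big_rec2: _ => [|i x y _ [chi_y hy]]; first by split; [|apply: hopf_one].
  split; first by rewrite mul ?chi_y //; apply: hopf_gen.
  by apply: hopf_mul => //; apply: hopf_gen.
have -> : chi D = \sum_(s : 'S_N) (- qC q) ^+ perm_length s * \prod_i chi (u i (s i)).
  suff [] : chi D = \sum_(s : 'S_N)
      (- qC q) ^+ perm_length s * \prod_i chi (u i (s i)) /\ hopf D by [].
  rewrite /qdet; elim/big_rec2: _ => [|s x y _ [chi_y hy]].
    by split=> //; apply: in_hopf0.
  have hs := in_hopf_prod_gen s.
  by split; [rewrite lin // chi_y chi_prod | apply: hopf_lin].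
rewrite (bigD1 1%g) //= [X in _ + X]big1 ?addr0 => [|s s1].
  rewrite perm_length1 expr0 mul1r; apply: eq_bigr => i _.
  by rewrite chi_u perm1 eqxx.
have [i si] : exists i, s i != i.
  apply/existsP; apply: contraR s1; rewrite negb_exists => /forallP H.
  by apply/eqP/permP => i; rewrite perm1; apply/eqP; have := H i; rewrite negbK.
by rewrite (bigD1 i) //= chi_u eq_sym (negbTE si) mulr0n mul0r mulr0.
Qed.

(** The point is uniformity: [m] and [p] depend on [x] and not on [chi], so one polynomial describes
    both the torus axis and [K]. Denominators come from [d], where chi(d) t = chi(d) chi(D) = 1. *)
Lemma hopf_character_laurent (i0 : 'I_N) x : hopf x ->
  exists m (p : {poly R[i]}), forall chi (t : R[i]),
    hopf_character chi ->
    (forall i j, chi (u i j) = (if i == i0 then t else 1) *+ (i == j)) ->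
  chi x * t ^+ m = p.[t].
Proof.
elim=> {x} [|i j||c x y hx [m [p xE]] hy [m' [p' yE]]|x y hx [m [p xE]] hy [m' [p' yE]]].
- by exists 0%N, 1 => chi t [_ _ one] _; rewrite one expr0 mulr1 hornerC.
- exists 0%N, ((if i == i0 then 'X else 1) *+ (i == j)) => chi t _ ->.
  rewrite expr0 mulr1 hornerMn; case: ifP => _; first by rewrite hornerX.
  by rewrite hornerC.
- exists 1%N, 1 => chi t chi_hopf chi_u; have := hopf_character_qdet chi_hopf chi_u.
  rewrite (bigD1 i0) //= eqxx big1 ?mulr1 => [tE|i /negbTE-> //].
  case: chi_hopf => _ mul one; rewrite expr1 -tE -mul.
  + by rewrite (qu_dl rel) one hornerC.
  + exact: hopf_dinv.
  + exact: in_hopf_qdet.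
- exists (m + m')%N, (c *: p * 'X^m' + p' * 'X^m) => chi t chi_hopf chi_u.
  rewrite !hornerE -(xE chi t) // -(yE chi t) // exprD.
  case: chi_hopf => lin _ _; rewrite lin //; ring.
- exists (m + m')%N, (p * p') => chi t chi_hopf chi_u.
  rewrite hornerM -(xE chi t) // -(yE chi t) // exprD.
  case: chi_hopf => _ mul _; rewrite mul //; ring.
Qed.

Variable piT : A -> 'rV[R[i]]_N -> R[i].
Hypothesis piT_hom : is_torus_hom u d piT.

Lemma torus_star_character z : torus z -> star_character (piT^~ z).
Proof. by case: piT_hom => _ H _ _ /H []. Qed.

Lemma torus_hopf_character z : torus z -> hopf_character (piT^~ z).
Proof. by case: piT_hom => _ H _ _ /H []. Qed.

Definition torus_mul (z w : 'rV[R[i]]_N) : 'rV[R[i]]_N := \row_i (z 0 i * w 0 i).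

Lemma torus_torus_mul z w : torus z -> torus w -> torus (torus_mul z w).
Proof. by move=> tz tw i; rewrite mxE normrM tz tw mulr1. Qed.

Lemma piT_qdet z : torus z -> piT D z = \prod_i z 0 i.
Proof.
move=> tz; apply: (hopf_character_qdet (torus_hopf_character tz)) => i j.
by case: piT_hom => _ _ piu _; rewrite piu.
Qed.

Lemma piT_qdet_neq0 z : torus z -> piT D z != 0.
Proof.
move=> tz; rewrite piT_qdet //; apply/prodf_neq0 => i _.
by rewrite -normr_eq0 tz oner_eq0.
Qed.

Variables (T : cstarAlgType R) (i1 i2 delta : A -> T).
Hypotheses (T_min : is_min_tensor i1 i2) (delta_comul : is_comultiplication i1 i2 u delta).

Section Torus2.
Variables z w : 'rV[R[i]]_N.
Hypotheses (tz : torus z) (tw : torus w).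

(** Many lists represent the same element of [T]. Asking for one suitable list makes the property
    stable under the algebra operations; [product_character_eq] carries the value over to any other
    list. *)
Let comultiplicative_at (x : A) : Prop := exists t : seq (A * A),
  delta x = tensor_in i1 i2 t /\
  product_functional (piT^~ z) (piT^~ w) t = piT x (torus_mul z w).

Let comul1 : comultiplicative_at 1.
Proof.
exists [:: (1, 1)]; rewrite /tensor_in /product_functional !big_seq1 /=.
have [_ _ pi1z _] := torus_star_character tz.
have [_ _ pi1w _] := torus_star_character tw.
have [_ _ pi1zw _] := torus_star_character (torus_torus_mul tz tw).
case: delta_comul => -[_ _ -> _] _; case: T_min => -[_ _ -> _] [_ _ -> _] _ _ _.
by rewrite pi1z pi1w pi1zw !mulr1.
Qed.

Let comul_lin (c : R[i]) x y :
  comultiplicative_at x -> comultiplicative_at y -> comultiplicative_at (c *: x + y).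
Proof.
case=> t [tx pit] [s [sy pis]]; exists (tensor_scale c t ++ s).
have [linz _ _ _] := torus_star_character tz.
have [linzw _ _ _] := torus_star_character (torus_torus_mul tz tw).
case: delta_comul => -[lin _ _ _] _; case: T_min => h1 h2 _ _ _.
rewrite tensor_inD tensor_inZ // lin tx sy; split=> //.
rewrite product_functionalD pis linzw -pit; congr (_ + _).
rewrite /product_functional big_map mulr_sumr; apply: eq_bigr => p _ /=.
have piz0 : piT 0 z = 0.
  by have := linz (-1) 0 0; rewrite scaler0 addr0 mulN1r addNr; apply.
by rewrite -[_ *: _]addr0 linz piz0 addr0 mulrA.
Qed.

Let comul_mul x y :
  comultiplicative_at x -> comultiplicative_at y -> comultiplicative_at (x * y).
Proof.
case=> t [tx pit] [s [sy pis]]; exists (tensor_mul t s).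
have [_ mz _ _] := torus_star_character tz.
have [_ mw _ _] := torus_star_character tw.
have [_ mzw _ _] := torus_star_character (torus_torus_mul tz tw).
case: delta_comul => -[_ mul _ _] _; case: T_min => h1 h2 h12 _ _.
by rewrite tensor_inM // product_functionalM // mul tx sy mzw pit pis.
Qed.

Let comul_gen i j : comultiplicative_at (u i j).
Proof.
exists [seq (u i k, u k j) | k <- index_enum 'I_N].
rewrite /tensor_in /product_functional !big_map; split.
  by case: delta_comul => _ ->.
case: piT_hom => _ _ piu _; rewrite piu; last exact: torus_torus_mul.
rewrite (bigD1 i) //= big1 ?addr0 => [|k ki].
  by rewrite !piu // eqxx mulr1n mulrnAr mxE.
by rewrite piu // eq_sym (negbTE ki) mulr0n mul0r.
Qed.

Let comul0 : comultiplicative_at 0.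
Proof. by rewrite -(addNr 1) -scaleN1r; apply: comul_lin. Qed.

Let comul_qdet : comultiplicative_at D.
Proof.
apply: (big_ind comultiplicative_at) => [|x y hx hy|s _] //; first by rewrite -[x]scale1r; apply: comul_lin.
rewrite -[_ *: _]addr0; apply: comul_lin => //.
exact: (big_ind comultiplicative_at).
Qed.

Let comul_qdetX m : comultiplicative_at (D ^+ m).
Proof. by elim: m => [|m IH]; rewrite ?expr0 // exprS; apply: comul_mul. Qed.

(* Multiplying by a power of the central element qdet removes its inverse, and
   leaves a polynomial in the generators. *)
Let comul_hopf x : hopf x -> exists m, comultiplicative_at (x * D ^+ m).
Proof.
elim=> {x} [|i j||c x y hx [m xm] hy [m' ym']|x y hx [m xm] hy [m' ym']].
- by exists 0%N; rewrite mul1r.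
- by exists 0%N; rewrite mulr1.
- by exists 1%N; rewrite expr1 (qu_dl rel).
- exists (m + m')%N; rewrite mulrDl -scalerAl {2}addnC !exprD !mulrA.
  by apply: comul_lin; apply: comul_mul.
- exists (m + m')%N; rewrite exprD -mulrA [y * _]mulrA -[y * _]qdetX_central //.
  by rewrite -!mulrA mulrA; apply: comul_mul.
Qed.

(** Suitable lists exist for x D^m and for D^m. Multiplying the given list by the one for D^m yields
    a second representative of delta(x D^m), so the two values agree, and the value at D^m is
    nonzero and can be cancelled. *)
Lemma product_torus_character x (t : seq (A * A)) :
    hopf x -> delta x = tensor_in i1 i2 t ->
  product_functional (piT^~ z) (piT^~ w) t = piT x (torus_mul z w).
Proof.
move=> hx xt; have [m [s [xs pis]]] := comul_hopf hx.
have [r [mr pir]] := comul_qdetX m.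
have tzw := torus_torus_mul tz tw.
have [_ mz oz sz] := torus_star_character tz.
have [_ mw ow sw] := torus_star_character tw.
have [_ mzw ozw szw] := torus_star_character tzw.
case: (delta_comul) => -[_ mul _ _] _; case: (T_min) => h1 h2 h12 _ _.
have Dm0 : piT (D ^+ m) (torus_mul z w) != 0.
  elim: m {xs pis mr pir} => [|m IH]; first by rewrite expr0 ozw oner_eq0.
  by rewrite exprS mzw mulf_neq0 // piT_qdet_neq0.
apply: (mulIf Dm0); rewrite -mzw -pir -product_functionalM // -pis.
apply: (product_character_eq T_min); rewrite ?tensor_inM //.
- exact: torus_star_character.
- exact: torus_star_character.
by rewrite -xt -mr -xs mul.
Qed.

End Torus2.

Lemma torus_rep_mul n (U : 'M[A]_n) z w : unitary_rep i1 i2 delta U ->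
    (forall i j, hopf (U i j)) -> torus z -> torus w ->
  map_mx (piT^~ (torus_mul z w)) U = map_mx (piT^~ z) U *m map_mx (piT^~ w) U.
Proof.
case=> dU _ _ hU tz tw; apply/matrixP => i j; rewrite !mxE.
rewrite -(@product_torus_character z w tz tw (U i j)
  [seq (U i k, U k j) | k <- index_enum 'I_n]) //.
- by rewrite /product_functional big_map; apply: eq_bigr => k _; rewrite !mxE.
- by rewrite dU /tensor_in big_map.
Qed.

End HopfAlgebra.

(** * Weights of the torus *)

Lemma poly_eq0_inj (F : idomainType) (p : {poly F}) (f : nat -> F) :
  injective f -> (forall k, p.[f k] = 0) -> p = 0.
Proof.
move=> f_inj pf; apply: (@roots_geq_poly_eq0 _ _ (mkseq f (size p))).
- by apply/allP => _ /mapP[k _ ->]; apply/rootP.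
- by rewrite mkseq_uniq.
- by rewrite size_mkseq.
Qed.

Section OneParameter.
Variable R : realType.
Local Notation C := R[i].

(** The Cayley transform of k + 1: an algebraic supply of infinitely many distinct points of the
    unit circle. *)
Definition circle_point (k : nat) : C := (k.+1%:R + 'i) / (k.+1%:R - 'i).

Lemma circle_point_den k : (k.+1%:R - 'i : C) != 0.
Proof.
rewrite subr_eq0; apply/negP => /eqP e.
have : (k.+1%:R : C) \is Num.real by rewrite realn.
by rewrite e => /Creal_ImP; rewrite Im_i; apply/eqP/oner_neq0.
Qed.

Lemma norm_circle_point k : `|circle_point k| = 1.
Proof.
rewrite normf_div; have -> : k.+1%:R + 'i = (k.+1%:R - 'i : C)^*.
  by rewrite rmorphB /= conjCi opprK conjC_nat.
by rewrite norm_conjC divff // normr_eq0 circle_point_den.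
Qed.

Lemma circle_point_inj : injective circle_point.
Proof.
move=> k l /eqP; rewrite eqr_div ?circle_point_den // => /eqP e.
have : ('i : C) * (l%:R - k%:R) * 2%:R = 0.
  transitivity ((k.+1%:R + 'i) * (l.+1%:R - 'i) - (l.+1%:R + 'i) * (k.+1%:R - 'i) : C).
    rewrite -[k.+1%:R]natr1 -[l.+1%:R]natr1; ring.
  by rewrite e subrr.
move/eqP; rewrite !mulf_eq0 pnatr_eq0 (negbTE (neq0Ci _)) orbF /= subr_eq0 eqr_nat.
by move/eqP.
Qed.

Lemma poly_circle_eq0 (p : {poly C}) :
  (forall z, `|z| = 1 -> p.[z] = 0) -> p = 0.
Proof.
move=> pz; apply: (poly_eq0_inj circle_point_inj) => k.
exact/pz/norm_circle_point.
Qed.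

Local Notation "P .{ t }" := (map_mx (horner^~ t) P) (at level 2, format "P .{ t }").

(** With one variable fixed, each entry is a polynomial identity in the other, which extends from
    the circle to all of C. The variable z is freed while w stays on the circle, and w is freed for
    arbitrary z. *)
Lemma multiplicative_poly_mx n (P : 'M[{poly C}]_n) :
    (forall z w, `|z| = 1 -> `|w| = 1 -> P.{z * w} = P.{z} *m P.{w}) ->
  forall z w, P.{z * w} = P.{z} *m P.{w}.
Proof.
move=> Pmul.
have step1 z w : `|w| = 1 -> P.{z * w} = P.{z} *m P.{w}.
  move=> w1; apply/matrixP => i j.
  suff e : P i j \Po (w *: 'X) - \sum_k (P k j).[w] *: P i k = 0.
    have /(congr1 (horner^~ z)) := e.
    rewrite !hornerE horner_comp !hornerE horner_sum => /eqP.
    rewrite subr_eq0 mulrC !mxE => /eqP ->; apply: eq_bigr => k _.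
    by rewrite !mxE hornerZ mulrC.
  apply: poly_circle_eq0 => {}z z1.
  have := Pmul z w z1 w1 => /matrixP/(_ i j); rewrite !mxE => e.
  rewrite !hornerE horner_comp !hornerE mulrC e horner_sum; apply/eqP.
  rewrite subr_eq0; apply/eqP/eq_bigr => k _; by rewrite !mxE hornerZ mulrC.
move=> z w; apply/matrixP => i j.
suff e : P i j \Po (z *: 'X) - \sum_k (P i k).[z] *: P k j = 0.
  have /(congr1 (horner^~ w)) := e.
  rewrite !hornerE horner_comp !hornerE horner_sum => /eqP.
  rewrite subr_eq0 !mxE => /eqP ->; apply: eq_bigr => k _.
  by rewrite !mxE hornerZ.
apply: poly_circle_eq0 => {}w w1.
have := step1 z w w1 => /matrixP/(_ i j); rewrite !mxE => e.
rewrite !hornerE horner_comp !hornerE e horner_sum; apply/eqP.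
by rewrite subr_eq0; apply/eqP/eq_bigr => k _; rewrite !mxE hornerZ.
Qed.

(* A vector scaled by s^a at s is scaled by s^(ka) at s^k; these points are
   infinitely many, so the scaling holds for every t. *)
Lemma one_parameter_eigenvector n (P : 'M[{poly C}]_n) (s : C) (a : int) (v : 'cV[C]_n) :
    (forall z w, `|z| = 1 -> `|w| = 1 -> P.{z * w} = P.{z} *m P.{w}) ->
    0 < s < 1 -> P.{s} *m v = s ^ a *: v ->
  forall t, t != 0 -> P.{t} *m v = t ^ a *: v.
Proof.
move=> /multiplicative_poly_mx Pmul /andP[s_gt0 s_lt1] Ps t t0.
have s0 : s != 0 by rewrite gt_eqF.
have Psk k : P.{s ^+ k.+1} *m v = (s ^+ k.+1) ^ a *: v.
  elim: k => [|k IH]; first by rewrite expr1.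
  by rewrite exprS Pmul -mulmxA IH -scalemxAr Ps scalerA exprzMl ?unitfE ?expf_neq0 // mulrC.
(* Multiplication by t^b removes a possibly negative exponent: b + a = c is a natural number, and
   the claim becomes an identity of polynomials. *)
pose b := `|a|%N; pose c := `|(b%:Z + a)%R|%N.
have cE : c%:Z = b%:Z + a by rewrite /c /b; lia.
apply/matrixP => i j; rewrite [in RHS]mxE ord1.
apply: (mulfI (expf_neq0 b t0)); rewrite mulrA.
have -> : t ^+ b * t ^ a = t ^+ c by rewrite !exprnP -expfzDr // cE.
suff e : 'X^b * \sum_k v k 0 *: P i k - v i 0 *: 'X^c = 0.
  have /(congr1 (horner^~ t)) := e; rewrite !hornerE horner_sum => /eqP.
  rewrite subr_eq0 [v i 0 * _]mulrC => /eqP <-; congr (_ * _).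
  by rewrite mxE; apply: eq_bigr => k _; rewrite mxE hornerZ mulrC.
apply: (@poly_eq0_inj _ _ (fun k => s ^+ k.+1)) => [k l|k].
  by move/(ieexprIn s_gt0 (negbT (lt_eqF s_lt1))) => [].
have sk0 : s ^+ k.+1 != 0 by rewrite expf_neq0.
have /matrixP/(_ i 0) := Psk k; rewrite !mxE => e.
rewrite !hornerE horner_sum; apply/eqP; rewrite subr_eq0; apply/eqP.
have -> : \sum_(l < n) (v l 0 *: P i l).[s ^+ k.+1] = (s ^+ k.+1) ^ a * v i 0.
  by rewrite -e; apply: eq_bigr => l _; rewrite mxE hornerZ mulrC.
by rewrite mulrA mulrC !exprnP -expfzDr // cE.
Qed.
End OneParameter.

Section TorusWeights.
Variables (R : realType) (q : R) (N : nat) (A : cstarAlgType R).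
Hypotheses (q_gt0 : 0 < q) (q_lt1 : q < 1).
Variables (u : 'M[A]_N) (d : A).
Hypothesis rel : qunitary_relations q u d.
Variables (K : {ffun 'I_N -> int} -> A -> R[i]) (E : 'I_N -> A -> R[i]).
Hypothesis KE : gl_pairing q u d K E.
Variable piT : A -> 'rV[R[i]]_N -> R[i].
Hypothesis piT_hom : is_torus_hom u d piT.
Variables (T : cstarAlgType R) (i1 i2 delta : A -> T).
Hypotheses (T_min : is_min_tensor i1 i2) (delta_comul : is_comultiplication i1 i2 u delta).
Variables (n : nat) (U : 'M[A]_n).
Hypotheses (U_rep : unitary_rep i1 i2 delta U) (U_hopf : forall i j, in_hopf u d (U i j)).

Lemma sqrt_qC_bounds : 0 < sqrt_qC q < 1.
Proof.
rewrite ltcR -[1]/(1%:C)%C ltcR sqrtr_gt0 q_gt0 /=.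
by rewrite -[X in _ < X]sqrtr1 ltr_sqrt.
Qed.

Definition torus_axis (i0 : 'I_N) (t : R[i]) : 'rV[R[i]]_N :=
  \row_i (if i == i0 then t else 1).

Lemma torus_torus_axis i0 t : `|t| = 1 -> torus (torus_axis i0 t).
Proof. by move=> t1 i; rewrite mxE; case: ifP => _ //; rewrite normr1. Qed.

Lemma torus_axisM i0 t s :
  torus_axis i0 (t * s) = torus_mul (torus_axis i0 t) (torus_axis i0 s).
Proof. by apply/rowP => i; rewrite !mxE; case: ifP; rewrite ?mulr1. Qed.

Lemma axis_polynomial (i0 : 'I_N) : exists m (P : 'M[{poly R[i]}]_n),
  forall chi (t : R[i]), hopf_character u d chi ->
    (forall i j, chi (u i j) = (if i == i0 then t else 1) *+ (i == j)) ->
  map_mx (horner^~ t) P = t ^+ m *: map_mx chi U.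
Proof.
have /fin_all_exists[m H1] : forall ij : 'I_n * 'I_n, exists m, exists p : {poly R[i]},
    forall chi (t : R[i]), hopf_character u d chi ->
    (forall i j, chi (u i j) = (if i == i0 then t else 1) *+ (i == j)) ->
    chi (U ij.1 ij.2) * t ^+ m = p.[t].
  by move=> ij; apply: (hopf_character_laurent rel).
have {H1}/fin_all_exists[p H] := H1.
(* The sum of the entrywise exponents serves as a common denominator for all entries. *)
exists (\sum_ij m ij)%N, (\matrix_(i, j) (p (i, j) * 'X^(\sum_ij m ij - m (i, j)))).
move=> chi t chi_hopf chi_u; apply/matrixP => i j.
rewrite !mxE hornerM hornerXn -(H (i, j) chi t chi_hopf chi_u) -mulrA -exprD.
rewrite subnKC; first by rewrite mulrC.
by rewrite (bigD1 (i, j)) //= leq_addr.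
Qed.

(** The same [P] gives the torus action for |t| = 1 and the action of [K (eps i0)] at t = sqrt q.
    Clearing denominators shifts the weight from [a i0] to [m + a i0]. *)
Lemma torus_axis_weight a v (i0 : 'I_N) t :
    weight_vector q K U a v -> `|t| = 1 ->
  map_mx (piT^~ (torus_axis i0 t)) U *m v = t ^ a i0 *: v.
Proof.
case=> _ /(_ i0) Kv t1; have [m [P PE]] := axis_polynomial i0.
have P_axis s : `|s| = 1 ->
    map_mx (horner^~ s) P = s ^+ m *: map_mx (piT^~ (torus_axis i0 s)) U.
  move=> s1; have ts := torus_torus_axis i0 s1.
  apply: PE; first exact: torus_hopf_character ts.
  by move=> i j; case: piT_hom => _ _ piu _; rewrite piu // mxE.
have /andP[s_gt0 s_lt1] := sqrt_qC_bounds.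
have P_sqrt : map_mx (horner^~ (sqrt_qC q)) P =
    sqrt_qC q ^+ m *: map_mx (K (eps i0)) U.
  apply: PE; first by case: KE => lin mul one _ _ _ _; split=> *; [apply: lin | apply: mul | apply: one].
  move=> i j; case: KE => _ _ _ gen _ _ _; rewrite gen ffunE eq_sym.
  by case: eqP => _; rewrite ?expr1z ?expr0z.
have t0 : t != 0 by rewrite -normr_eq0 t1 oner_eq0.
have s0 : sqrt_qC q != 0 by rewrite (gt_eqF s_gt0).
have tE : t ^ (m%:Z + a i0) = t ^+ m * t ^ a i0 by rewrite expfzDr.
have sqE : sqrt_qC q ^ (m%:Z + a i0) = sqrt_qC q ^+ m * sqrt_qC q ^ a i0.
  exact: (expfzDr m%:Z (a i0) s0).
apply: (scalerI (expf_neq0 m t0)); rewrite scalemxAl -P_axis // scalerA -tE.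
apply: (one_parameter_eigenvector (s := sqrt_qC q)) => //; last first.
- by rewrite P_sqrt -scalemxAl Kv scalerA sqE.
- exact: sqrt_qC_bounds.
move=> z w z1 w1; rewrite !P_axis ?normrM ?z1 ?w1 ?mulr1 // torus_axisM.
rewrite (torus_rep_mul rel piT_hom T_min delta_comul U_rep U_hopf).
- by rewrite -scalemxAl -scalemxAr scalerA exprMn.
- exact: torus_torus_axis.
- exact: torus_torus_axis.
Qed.

(** A torus point is the product of its axis components, so its coordinates are switched on one at a
    time, each multiplying the eigenvalue by its own power. *)
Lemma torus_weight a v z : (0 < N)%N -> weight_vector q K U a v -> torus z ->
  map_mx (piT^~ z) U *m v = (\prod_i z 0 i ^ a i) *: v.
Proof.
move=> N_gt0 wv tz.
pose partial (s : seq 'I_N) : 'rV[R[i]]_N := \row_i (if i \in s then z 0 i else 1).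
have tpartial s : torus (partial s).
  by move=> i; rewrite mxE; case: ifP => _; rewrite ?normr1 ?tz.
suff H s : uniq s -> map_mx (piT^~ (partial s)) U *m v = (\prod_(i <- s) z 0 i ^ a i) *: v.
  have := H _ (index_enum_uniq 'I_N); suff -> : partial (index_enum 'I_N) = z by [].
  by apply/rowP => i; rewrite mxE mem_index_enum.
elim: s => [_|i s IH /= /andP[i_s us]].
  (* The unit of the torus lies on every axis; [N_gt0] provides an axis. *)
  have -> : partial [::] = torus_axis (Ordinal N_gt0) 1.
    by apply/rowP => i; rewrite !mxE; case: ifP.
  by rewrite (torus_axis_weight _ wv) ?normr1 // exp1rz big_nil.
have -> : partial (i :: s) = torus_mul (partial s) (torus_axis i (z 0 i)).
  apply/rowP => j; rewrite !mxE inE; case: (eqVneq j i) => [->|_] /=.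
    by rewrite (negbTE i_s) mul1r.
  by rewrite mulr1.
rewrite (torus_rep_mul rel piT_hom T_min delta_comul U_rep U_hopf) //; last first.
  exact/torus_torus_axis/tz.
by rewrite -mulmxA (torus_axis_weight i wv (tz i)) -scalemxAr IH // scalerA big_cons.
Qed.

End TorusWeights.

(** * Traces against the density matrix *)

(** With s i = |nu^(i)| this turns the exponent produced by z_i -> q^(-2(i-1)) z_i into -2(N-1)|nu|
    + 2 sum |nu^(n)|, which is the density exponent up to (N-1)|nu|. *)
Lemma summation_by_parts (s : nat -> int) n :
  \sum_(i < n.+1) i%:Z * (s i.+1 - s i) = n%:Z * s n.+1 - \sum_(1 <= k < n.+1) s k.
Proof.
elim: n => [|n IH]; first by rewrite big_ord1 big_geq // !mul0r subr0.
rewrite big_ord_recr /= IH [in RHS]big_nat_recr //= intS; ring.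
Qed.

Section SchurWeights.
Variables (R : realType) (q : R) (N : nat).
Hypotheses (q_gt0 : 0 < q) (q_lt1 : q < 1) (N_gt0 : (0 < N)%N).
Local Notation C := R[i].

Lemma qC_gt0 : 0 < qC q. Proof. by rewrite -[0]/(0%:C)%C ltcR. Qed.

Lemma qC_neq0 : qC q != 0. Proof. by rewrite gt_eqF ?qC_gt0. Qed.

Lemma qC_neq1 : qC q != 1. Proof. by rewrite lt_eqF // -[1]/(1%:C)%C ltcR. Qed.

(** Distinct variables make the denominator in [schur] nonzero. Twisted torus points qualify, their
    coordinates having the distinct moduli q^(-2i). *)
Lemma schur_gt_patterns (nu : Sign N) (x : 'rV[C]_N) :
    (forall i, x 0 i != 0) -> injective (x 0) ->
  schur nu x = \sum_(t <- gt_patterns N (val nu))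
    \prod_i x 0 i ^ (level_size t i.+1 - level_size t i).
Proof.
move=> x0 x_inj; pose y k := if insub k is Some i then x 0 i else 1.
have yE (i : 'I_N) : y i = x 0 i by rewrite /y valK.
have := @partition_det_gt_patterns C N (val nu) y (size_tuple _) (valP nu).
have -> : partition_det N (val nu) y =
    \det (\matrix_(i < N, j < N) x 0 i ^ (sign_part nu j + (N - j.+1)%:Z)).
  by congr (\det _); apply/matrixP => i j; rewrite !mxE yE /sign_part (tnth_nth 0).
have -> : vandermonde_prod N y = \prod_(i < N) \prod_(j < N | (i < j)%N) (x 0 i - x 0 j).
  by apply: eq_bigr => i _; apply: eq_bigr => j _; rewrite !yE.
move=> detE; rewrite /schur detE; last first.
  by move=> i iN; have := x0 (Ordinal iN); rewrite -yE.
rewrite mulrAC divff ?mul1r; last first.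
  apply/prodf_neq0 => i _; apply/prodf_neq0 => j ij.
  by rewrite subr_eq0; apply/eqP => /x_inj e; rewrite e ltnn in ij.
by apply: eq_bigr => t _; apply: eq_bigr => i _; rewrite yE.
Qed.

(** Turns a sum over the vectors of an abstract Gelfand-Tsetlin basis into a sum over the
    recursively generated list. *)
Lemma perm_gt_patterns (nu : Sign N) n (gt : 'I_n -> N.-tuple (seq int)) :
    injective gt -> (forall t, gt_pattern nu t <-> exists k, gt k = t) ->
  perm_eq [seq tval (gt k) | k <- index_enum 'I_n] (gt_patterns N (val nu)).
Proof.
move=> gt_inj gtP; apply: uniq_perm.
- rewrite map_inj_uniq ?index_enum_uniq // => k l /val_inj; exact: gt_inj.
- exact/uniq_gt_patterns/size_tuple.
have patP (t : N.-tuple (seq int)) : gt_pattern nu t <-> tval t \in gt_patterns N (val nu).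
  have -> := mem_gt_patterns (tval t) (size_tuple (val nu)) (valP nu).
  split=> [[H1 H2 H3]|[_ H1 H2 H3]].
    split=> [|i iN|i iN|_]; first exact: size_tuple.
    - by have := H1 (Ordinal iN); rewrite (tnth_nth [::]).
    - have := H2 (Ordinal (ltnW iN)) (Ordinal iN) erefl.
      by rewrite !(tnth_nth [::]).
    - have N1 : (N.-1 < N)%N by rewrite prednK.
      by have := H3 (Ordinal N1); rewrite (tnth_nth [::]) /= prednK //; apply.
  split=> [k|k k' kk'|k kN]; rewrite !(tnth_nth [::]).
  - exact: H1.
  - by rewrite kk'; apply: H2; rewrite -kk'.
  - by have := H3 N_gt0; have -> : N.-1 = k by rewrite -[in LHS]kN.
move=> t; apply/mapP/idP => [[k _ ->]|tP].
  by apply/patP/gtP; exists k.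
have st : size t == N by apply/eqP/(size_gt_patterns tP).
have /gtP[k gtk] : gt_pattern nu (Tuple st) by apply/patP.
by exists k; rewrite ?mem_index_enum // gtk.
Qed.

Lemma qtwist_neq0 (z : 'rV[C]_N) i : torus z -> qtwist q z 0 i != 0.
Proof.
move=> tz; rewrite mxE mulf_neq0 ?invr_neq0 ?expf_neq0 ?qC_neq0 //.
by rewrite -normr_eq0 tz oner_eq0.
Qed.

Lemma qtwist_inj (z : 'rV[C]_N) : torus z -> injective (qtwist q z 0).
Proof.
move=> tz i j /(congr1 Num.norm); rewrite !mxE !normrM !tz !mulr1.
rewrite !ger0_norm ?invr_ge0 ?exprn_ge0 ?ltW ?qC_gt0 // => /invr_inj.
move/(ieexprIn qC_gt0 qC_neq1)/eqP; rewrite eqn_pmul2l // => /eqP; exact: val_inj.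
Qed.

Lemma gt_density_weight (nu : Sign N) (t : N.-tuple (seq int)) (z : 'rV[C]_N) :
    tval t \in gt_patterns N (val nu) ->
  gt_density q nu t * \prod_i z 0 i ^ gt_weight t i =
  qC q ^ ((N.-1)%:Z * sign_size nu) *
  \prod_i qtwist q z 0 i ^ (level_size t i.+1 - level_size t i).
Proof.
move=> tP.
have -> : \prod_i qtwist q z 0 i ^ (level_size t i.+1 - level_size t i) =
   \prod_(i < N) qC q ^ (- (2%:Z * (i%:Z * (level_size t i.+1 - level_size t i)))) *
   \prod_i z 0 i ^ gt_weight t i.
  rewrite -big_split; apply: eq_bigr => i _ /=; rewrite mxE expfzMl; congr (_ * _).
  by rewrite exprnN exprz_exp mulNr PoszM mulrA.
rewrite mulrA; congr (_ * _).
rewrite (_ : \prod_(i < N) _ = qC q ^ (\sum_(i < N)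
    (- (2%:Z * (i%:Z * (level_size t i.+1 - level_size t i)))))); last first.
  by apply: (big_ind2 (fun (a : C) (b : int) => a = qC q ^ b)) => // a a' b b' -> ->;
    rewrite expfzDr ?qC_neq0.
rewrite -expfzDr ?qC_neq0 // /gt_density; congr (_ ^ _).
rewrite sumrN -mulr_sumr.
have sizeE : level_size t N = sign_size nu.
  have -> : level_size t N = level_size t N.-1.+1 by rewrite prednK.
  rewrite /= (last_gt_patterns tP) // /sign_size (big_nth 0) size_tuple big_mkord.
  by apply: eq_bigr => i _; rewrite /sign_part (tnth_nth 0).
have := summation_by_parts (level_size t) N.-1; rewrite prednK // sizeE => ->.
rewrite (_ : \sum_(1 <= n < N) gt_size t n = \sum_(1 <= n < N) level_size t n) //.
ring.
Qed.

Variables (A : cstarAlgType R) (u : 'M[A]_N) (d : A).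
Hypothesis rel : qunitary_relations q u d.
Variables (K : {ffun 'I_N -> int} -> A -> C) (E : 'I_N -> A -> C).
Hypothesis KE : gl_pairing q u d K E.
Variable piT : A -> 'rV[C]_N -> C.
Hypothesis piT_hom : is_torus_hom u d piT.
Variables (T : cstarAlgType R) (i1 i2 delta : A -> T).
Hypotheses (T_min : is_min_tensor i1 i2) (delta_comul : is_comultiplication i1 i2 u delta).
Variables (n : nat) (U : 'M[A]_n).
Hypotheses (U_rep : unitary_rep i1 i2 delta U) (U_hopf : forall i j, in_hopf u d (U i j)).
Variables (nu : Sign N) (F P : 'M[C]_n) (gt : 'I_n -> N.-tuple (seq int)).
Hypothesis U_gt : gt_basis q K nu U F P gt.

(** [F] and [B] are simultaneously diagonal in the columns of [P]. Similarity suffices for the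
    trace, so the basis need not be orthonormal. *)
Lemma trace_gt_basis (B : 'M[C]_n) (b : 'I_n -> C) :
    (forall k, B *m col k P = b k *: col k P) ->
  \tr (F *m B) = \sum_k gt_density q nu (gt k) * b k.
Proof.
case: U_gt => P_unit _ _ _ FP BP.
pose D := diag_mx (\row_k (gt_density q nu (gt k) * b k)).
have FBP : F *m B *m P = P *m D.
  apply/matrixP => i j.
  have -> : (F *m B *m P) i j = (F *m (B *m col j P)) i 0.
    by rewrite mulmxA colE mulmxA -colE [RHS]mxE.
  by rewrite BP -scalemxAr FP scalerA mul_mx_diag !mxE mulrC [b j * _]mulrC.
rewrite -[F *m B](mulmxK P_unit) mxtrace_mulC FBP mulKmx // mxtrace_diag.
by apply: eq_bigr => k _; rewrite mxE.
Qed.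

Lemma trace_torus z : torus z ->
  \tr (F *m map_mx (piT^~ z) U) = \sum_k gt_density q nu (gt k) * \prod_i z 0 i ^ gt_weight (gt k) i.
Proof.
move=> tz; apply: trace_gt_basis => k; case: U_gt => _ _ _ /(_ k) wk _.
exact: (torus_weight q_gt0 q_lt1 rel KE piT_hom T_min delta_comul U_rep U_hopf N_gt0 wk tz).
Qed.

Lemma trace_density : \tr F = \sum_k gt_density q nu (gt k).
Proof.
rewrite -[F]mulmx1 (trace_gt_basis (b := fun=> 1)) => [|k]; last first.
  by rewrite mul1mx scale1r.
by apply: eq_bigr => k _; rewrite mulr1.
Qed.

Lemma sum_gt_density_schur z : torus z ->
  \sum_k gt_density q nu (gt k) * \prod_i z 0 i ^ gt_weight (gt k) i =
  qC q ^ ((N.-1)%:Z * sign_size nu) * schur nu (qtwist q z).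
Proof.
move=> tz; case: U_gt => _ gt_inj gtP _ _.
have gtE := perm_gt_patterns gt_inj gtP.
rewrite schur_gt_patterns; last 2 first.
- by move=> i; apply: qtwist_neq0.
- exact: qtwist_inj.
rewrite -(perm_big _ gtE) big_map mulr_sumr; apply: eq_bigr => k _.
apply: gt_density_weight; rewrite -(perm_mem gtE).
exact: (map_f (fun k => tval (gt k)) (mem_index_enum k)).
Qed.

Lemma torus_one : torus (const_mx 1 : 'rV[C]_N).
Proof. by move=> i; rewrite mxE normr1. Qed.

Lemma trace_density_schur :
  \tr F = qC q ^ ((N.-1)%:Z * sign_size nu) * schur nu (qtwist q (const_mx 1)).
Proof.
rewrite trace_density -(sum_gt_density_schur torus_one); apply: eq_bigr => k _.
by rewrite big1 ?mulr1 // => i _; rewrite mxE exp1rz.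
Qed.

Lemma gt_density_gt0 (t : N.-tuple (seq int)) : 0 < gt_density q nu t.
Proof. by rewrite exprz_gt0 ?qC_gt0. Qed.

End SchurWeights.

(** * Positive matrices *)

Section DensityTrace.
Local Open Scope sesquilinear_scope.
Variables (R : realType) (n : nat).
Local Notation C := R[i].

(** Writes an eigenvalue as a value of the quadratic form, so that its sign or vanishing can be read
    off the form. *)
Lemma spectral_diagE (B : 'M[C]_n) k : B \is normalmx ->
  spectral_diag B 0 k = (row k (spectralmx B) *m B *m (row k (spectralmx B))^t*) 0 0.
Proof.
move=> /orthomx_spectralP BE; have V_unitary := spectral_unitarymx B.
have V_unit := spectral_unit B.
set V := spectralmx B in BE V_unitary V_unit *.
have e : V *m B *m V^t* = diag_mx (spectral_diag B).
  by rewrite {1}BE -(invmx_unitary V_unitary) !mulmxA mulmxV // mul1mx mulmxK.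
have -> : (row k V *m B *m (row k V)^t*) 0 0 = (V *m B *m V^t*) k k.
  by rewrite !mxE; apply: eq_bigr => j _; rewrite -row_mul !mxE.
by rewrite e !mxE eqxx mulr1n.
Qed.

Variable F : 'M[C]_n.
Hypothesis F_psd : forall v : 'cV[C]_n, 0 <= ((map_mx Num.conj v)^T *m F *m v) 0 0.

Lemma psd_row (x : 'rV[C]_n) : 0 <= (x *m F *m x^t*) 0 0.
Proof.
by have := F_psd (x^t* ); rewrite -map_mx_comp (map_mx_id (@conjCK _)) trmxK.
Qed.

(* F - F^* is normal, and its eigenvalues vanish because F takes real values. *)
Lemma psd_adjoint : F^t* = F.
Proof.
pose G := F - F^t*.
have adjG : G^t* = - G.
  by rewrite /G linearB /= map_mxB trmxCK opprB.
have G_normal : G \is normalmx.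
  by apply/normalmxP; rewrite adjG mulmxN mulNmx.
have /orthomx_spectralP GE := G_normal.
suff d0 : spectral_diag G = 0.
  apply/esym/eqP; rewrite -subr_eq0 -/G GE d0.
  by rewrite linear0 mulmx0 mul0mx.
apply/rowP => k; rewrite spectral_diagE // [in RHS]mxE.
set x := row k _; rewrite /G mulmxBr mulmxBl [LHS]mxE.
have /CrealP e := ger0_real (psd_row x).
rewrite [X in _ + X]mxE.
suff -> : (x *m F^t* *m x^t*) 0 0 = ((x *m F *m x^t*) 0 0)^* by rewrite e addrN.
transitivity (((x *m F *m x^t*)^t*) 0 0); last by rewrite !mxE.
by rewrite !trmx_mul !map_mxM trmxCK mulmxA.
Qed.

Lemma psd_normal : F \is normalmx.
Proof. by apply/normalmxP; rewrite psd_adjoint. Qed.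

Local Notation V := (spectralmx F).
Local Notation ev := (spectral_diag F 0).

Lemma trace_spectral (a : 'M[C]_n) :
  \tr (F *m a) = \sum_k ev k * (row k V *m (a *m (row k V)^t*)) 0 0.
Proof.
have /orthomx_spectralP FE := psd_normal; have V_unitary := spectral_unitarymx F.
rewrite {1}FE -!mulmxA mxtrace_mulC -mulmxA (invmx_unitary V_unitary).
apply: eq_bigr => k _; rewrite mul_diag_mx mxE; congr (_ * _).
rewrite -mulmxA [LHS]mxE [RHS]mxE; apply: eq_bigr => j _; rewrite [row k V 0 j]mxE.
by congr (_ * _); rewrite !mxE; apply: eq_bigr => l _; rewrite !mxE.
Qed.

Lemma spectral_diag_ge0 k : 0 <= ev k.
Proof. by rewrite spectral_diagE ?psd_normal // psd_row. Qed.

Lemma norm_row_spectral k : (row k V *m (row k V)^t*) 0 0 = 1.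
Proof.
have /unitarymxP/matrixP/(_ k k) := spectral_unitarymx F.
rewrite !mxE eqxx => e; apply: etrans e; apply: eq_bigr => j _; by rewrite !mxE.
Qed.

(** Summing 0 <= (r|x_j| - |y_j|)^2 gives 2r sum |x_j||y_j| <= 2r^2. Division by r forces the case r
    = 0 apart, where all y_j vanish. *)
Lemma cauchy_schwarz_unit (m : nat) (x y : 'I_m -> C) (r : C) : 0 <= r ->
    \sum_j `|x j| ^+ 2 = 1 -> \sum_j `|y j| ^+ 2 <= r ^+ 2 ->
  `|\sum_j x j * y j| <= r.
Proof.
move=> r0 x1 yr; have [r_eq0|r_neq0] := eqVneq r 0.
  rewrite r_eq0 expr0n /= in yr *.
  have y0 j : y j = 0.
    apply/eqP; rewrite -normr_eq0 -sqrf_eq0 eq_le exprn_ge0 // andbT.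
    by apply: le_trans yr; rewrite (bigD1 j) //= lerDl sumr_ge0 //.
  by rewrite big1 ?normr0 // => j _; rewrite y0 mulr0.
have r_gt0 : 0 < r by rewrite lt_def r_neq0.
apply: (le_trans (ler_norm_sum _ _ _)).
rewrite -(ler_pM2l (_ : 0 < r *+ 2)) ?pmulrn_lgt0 // mulr_sumr.
apply: (@le_trans _ _ (\sum_j (r ^+ 2 * `|x j| ^+ 2 + `|y j| ^+ 2))).
  apply: ler_sum => j _; rewrite normrM -subr_ge0.
  have : 0 <= (r * `|x j| - `|y j|) ^+ 2.
    rewrite real_exprn_even_ge0 // rpredB ?rpredM //; apply: ger0_real => //.
  congr (0 <= _); ring.
rewrite big_split /= -mulr_sumr x1 mulr1 mulrnAl -expr2 mulr2n.
exact: lerD.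
Qed.

(** In an orthonormal eigenbasis of [F] the trace is a combination of diagonal entries of [a] with
    nonnegative weights of total Tr(F), and each diagonal entry is at most r in modulus. *)
Lemma trace_psd_bound (a : 'M[C]_n) (r : R) : opnorm_le a r ->
  `|\tr (F *m a)| <= \tr F * (r%:C)%C.
Proof.
case=> r0 ar; rewrite trace_spectral -[in X in _ <= X](mulmx1 F) trace_spectral.
apply: (le_trans (ler_norm_sum _ _ _)); rewrite mulr_suml; apply: ler_sum => k _.
rewrite mul1mx norm_row_spectral mulr1 normrM ger0_norm ?spectral_diag_ge0 //.
apply: ler_wpM2l; first exact: spectral_diag_ge0.
have x1 : \sum_j `|(row k V) 0 j| ^+ 2 = 1.
  rewrite -(norm_row_spectral k) [RHS]mxE; apply: eq_bigr => j _.
  by rewrite normCK !mxE.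
rewrite mxE; apply: cauchy_schwarz_unit => //.
  by rewrite -[0]/(0%:C)%C lecR.
apply: (le_trans (ar _)).
suff -> : \sum_j `|(row k V)^t* j 0| ^+ 2 = 1 by rewrite mulr1.
by rewrite -x1; apply: eq_bigr => j _; rewrite !mxE norm_conjC.
Qed.

Lemma trace_psd_gram (x : 'M[C]_n) : 0 <= \tr (F *m ((map_mx Num.conj x)^T *m x)).
Proof.
rewrite mulmxA mxtrace_mulC mulmxA; apply: sumr_ge0 => k _.
have -> : (x *m F *m (map_mx Num.conj x)^T) k k = (row k x *m F *m (row k x)^t*) 0 0.
  rewrite -row_mul mxE [RHS]mxE; apply: eq_bigr => j _; by rewrite !mxE.
exact: psd_row.
Qed.

End DensityTrace.

(** * Unordered sums *)

Section UnorderedSums.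
Local Open Scope classical_set_scope.
Variables (R : realType) (I : choiceType).
Implicit Types (g : I -> R) (f : I -> R[i]).

Definition has_real_sum g (S : R) : Prop :=
  forall e : R, 0 < e -> exists A0 : {fset I}, forall A : {fset I},
    (A0 `<=` A)%fset -> `|\sum_(i <- A) g i - S| < e.

Lemma sum_fset_sub (V : nmodType) (h : I -> V) (A B : {fset I}) : (A `<=` B)%fset ->
  \sum_(i <- B) h i = \sum_(i <- A) h i + \sum_(i <- (B `\` A)%fset) h i.
Proof.
move=> /fsubsetP AB; rewrite -big_cat; apply/perm_big/uniq_perm.
- exact: fset_uniq.
- rewrite cat_uniq !fset_uniq andbT; apply/hasPn => i /=.
  by rewrite in_fsetD => /andP[].
move=> i; rewrite mem_cat in_fsetD; case: (boolP (i \in A)) => //= iA.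
exact: AB.
Qed.

Lemma has_real_sum_nonneg g : (forall i, 0 <= g i) ->
    (\esum_(i in [set: I]) (g i)%:E < +oo)%E -> exists S, has_real_sum g S.
Proof.
move=> g0 g_fin; pose S := (\esum_(i in [set: I]) (g i)%:E)%E.
have S_fin : S \is a fin_num.
  by rewrite ge0_fin_numE // esum_ge0 // => i _; rewrite lee_fin.
exists (fine S) => e e0.
have [_ [X [finX _] <-] Xe] := ub_ereal_sup_adherent e0 S_fin.
exists (fset_set X) => A XA; rewrite ltr_distl.
have SA : \sum_(i <- A) g i <= fine S.
  rewrite -lee_fin fineK //; apply: esum_ge; exists [set` A]; first by split.
  by rewrite fsbig_finite // set_fsetK sumEFin.
have XS : \sum_(i <- fset_set X) g i <= \sum_(i <- A) g i.
  by rewrite (sum_fset_sub _ XA) lerDl sumr_ge0.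
move: Xe; rewrite -/(esum _ _) -/S fsbig_finite // sumEFin -(fineK S_fin) /=.
rewrite -EFinB lte_fin => Xe.
by rewrite (lt_le_trans Xe XS) /= (le_lt_trans SA) // ltrDl.
Qed.

Lemma has_real_sumB g h S T :
  has_real_sum g S -> has_real_sum h T -> has_real_sum (fun i => g i - h i) (S - T).
Proof.
move=> gS hT e e0; have e2 : 0 < e / 2 by rewrite divr_gt0.
have [A0 H0] := gS _ e2; have [B0 K0] := hT _ e2.
exists (A0 `|` B0)%fset => A; rewrite fsubUset => /andP[/H0 HA /K0 KA].
rewrite sumrB; move: HA KA; set x := \sum_(i <- A) g i; set y := \sum_(i <- A) h i.
have -> : x - y - (S - T) = (x - S) - (y - T) by ring.
by move=> HA KA; rewrite (le_lt_trans (ler_normB _ _)) // [e]splitr ltrD.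
Qed.

(** Writes h = (h + g) - g, a difference of two nonnegative families with finite sums. *)
Lemma has_real_sum_dominated g h : (forall i, `|h i| <= g i) ->
    (\esum_(i in [set: I]) (g i)%:E < +oo)%E -> exists S, has_real_sum h S.
Proof.
move=> hg g_fin; have g0 i : 0 <= g i by apply: le_trans (hg i).
have [S gS] := has_real_sum_nonneg g0 g_fin.
have hg0 i : 0 <= h i + g i.
  by have := hg i; rewrite ler_norml => /andP[+ _]; rewrite -subr_ge0 opprK.
have [|T hgT] := has_real_sum_nonneg hg0.
  apply: (@le_lt_trans _ _ (\esum_(i in [set: I]) ((g i)%:E + (g i)%:E))%E).
    apply: le_esum => i _; rewrite -EFinD lee_fin lerD2r.
    exact: le_trans (ler_norm _) (hg i).
  by rewrite esumD ?lte_add_pinfty // => i _; rewrite lee_fin.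
exists (T - S); have := has_real_sumB hgT gS.
by rewrite (_ : (fun i => _) = h) //; apply/funext => i; rewrite addrK.
Qed.

Lemma norm_complex_le (x : R[i]) : `|x| <= ((`|complex.Re x| + `|complex.Im x|)%:C)%C.
Proof.
case: x => a b; rewrite normc_def lecR /=.
rewrite -[X in _ <= X]ger0_norm ?addr_ge0 // -sqrtr_sqr ler_sqrt ?sqr_ge0 //.
by rewrite sqrrD !real_normK ?num_real // -addrA lerD2l lerDr mulrn_wge0 // mulr_ge0.
Qed.

Lemma Re_le_norm (x : R[i]) (r : R) : `|x| <= (r%:C)%C -> `|complex.Re x| <= r.
Proof. by move=> xr; rewrite -lecR (le_trans (normc_ge_Re x)). Qed.

Lemma Im_le_norm (x : R[i]) (r : R) : `|x| <= (r%:C)%C -> `|complex.Im x| <= r.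
Proof.
move=> xr; rewrite -(lecR `|_| r); apply: le_trans xr; case: x => a b.
by rewrite normc_def lecR /= -sqrtr_sqr ler_wsqrtr // lerDr sqr_ge0.
Qed.

Lemma has_sum_dominated f g : (forall i, `|f i| <= ((g i)%:C)%C) ->
    (\esum_(i in [set: I]) (g i)%:E < +oo)%E -> exists s, has_sum f s.
Proof.
move=> fg g_fin.
have [a fa] := has_real_sum_dominated (fun i => Re_le_norm (fg i)) g_fin.
have [b fb] := has_real_sum_dominated (fun i => Im_le_norm (fg i)) g_fin.
exists (a +i* b)%C => e e0; have e2 : 0 < e / 2 by rewrite divr_gt0.
have [A0 H0] := fa _ e2; have [B0 K0] := fb _ e2.
exists (A0 `|` B0)%fset => A; rewrite fsubUset => /andP[/H0 HA /K0 KA] _ _.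
have ReE : complex.Re (\sum_(i <- A) f i - (a +i* b)%C) = \sum_(i <- A) complex.Re (f i) - a.
  by rewrite raddfB raddf_sum.
have ImE : complex.Im (\sum_(i <- A) f i - (a +i* b)%C) = \sum_(i <- A) complex.Im (f i) - b.
  by rewrite raddfB raddf_sum.
apply: (le_lt_trans (norm_complex_le _)); rewrite ltcR ReE ImE [e]splitr.
exact: ltrD.
Qed.

Lemma has_sum_unique f s t : has_sum f s -> has_sum f t -> s = t.
Proof.
move=> fs ft; apply/eqP; rewrite -subr_eq0 -normr_eq0.
apply: contraT => st0; pose e := complex.Re `|s - t|.
have eE : `|s - t| = (e%:C)%C by rewrite /e normc_def.
have e0 : 0 < e.
  have : 0 < `|s - t| by rewrite lt_def st0 normr_ge0.
  by rewrite eE -[0]/(0%:C)%C ltcR.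
have e2 : 0 < e / 2 by rewrite divr_gt0.
have [A0 H0] := fs _ e2; have [B0 K0] := ft _ e2.
have := H0 (A0 `|` B0)%fset (fsubsetUl _ _) tt Logic.I.
have := K0 (A0 `|` B0)%fset (fsubsetUr _ _) tt Logic.I.
set x := \sum_(i <- _) f i => xt xs.
have : `|s - t| < (e%:C)%C; last by rewrite eE ltxx.
have -> : s - t = (x - t) - (x - s) by ring.
apply: (le_lt_trans (ler_normB _ _)).
by rewrite [e in X in _ < X]splitr rmorphD ltrD.
Qed.

Lemma csumE f s : has_sum f s -> csum f = s.
Proof.
by move=> fs; rewrite /csum; apply: xget_unique => // t ft; apply: has_sum_unique ft fs.
Qed.

Lemma has_sum_support1 f (i0 : I) : (forall i, i != i0 -> f i = 0) -> has_sum f (f i0).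
Proof.
move=> f0 e e0; exists [fset i0]%fset => A; rewrite fsub1set => iA _ _.
rewrite (bigD1_seq i0) ?fset_uniq //= big1 ?addr0 => [|i /f0] //.
by rewrite subrr normr0 -[0]/(0%:C)%C ltcR.
Qed.

(** The Weierstrass M-test. The finite set is chosen from [g] alone, hence uniformly in x. *)
Lemma has_usum_dominated (X : Type) (D : set X) (f : I -> X -> R[i]) g :
    (forall i x, D x -> `|f i x| <= ((g i)%:C)%C) ->
    (\esum_(i in [set: I]) (g i)%:E < +oo)%E ->
  has_usum D f (fun x => csum (fun i => f i x)).
Proof.
move=> fg g_fin e e0.
(* Nonnegativity of [g] is deduced from a point of [D], so empty [D] is treated apart. *)
have [x0|] := pselect (exists x, D x); last first.
  by move=> noD; exists fset0 => A _ x Dx; case: noD; exists x.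
have g0 i : 0 <= g i.
  case: x0 => x Dx; have := le_trans (normr_ge0 _) (fg i x Dx).
  by rewrite -[0]/(0%:C)%C lecR.
have [S gS] := has_real_sum_nonneg g0 g_fin.
have e4 : 0 < e / 4 by rewrite divr_gt0.
have [A0 H0] := gS _ e4; exists A0 => A A0A x Dx.
have [s fs] := has_sum_dominated (fun i => fg i x Dx) g_fin.
(* [B0] depends on x but enters only through the comparison set A U B0. The part of [g] on it
   outside A is below e/4 + e/4, and the sum of f over A U B0 is within e/4 of s. *)
rewrite (csumE fs); have [B0 K0] := fs _ e4.
have AB : (A `<=` A `|` B0)%fset by apply: fsubsetUl.
have := K0 (A `|` B0)%fset (fsubsetUr _ _) tt Logic.I.
have := H0 (A `|` B0)%fset (fsubset_trans A0A AB).
have := H0 A A0A.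
rewrite !(sum_fset_sub _ AB).
set gA := \sum_(i <- A) g i; set gB := \sum_(i <- _) g i.
set fA := \sum_(i <- A) f i x; set fB := \sum_(i <- _) f i x => gA_lt gAB_lt fAB_lt.
have fB_le : `|fB| <= (gB%:C)%C.
  rewrite rmorph_sum; apply: (le_trans (ler_norm_sum _ _ _)).
  by apply: ler_sum => i _; apply: fg.
have gB_lt : gB < e / 2 by move: gA_lt gAB_lt; rewrite !ltr_norml; lra.
have -> : fA - s = (fA + fB - s) - fB by ring.
apply: (le_lt_trans (ler_normB _ _)).
apply: (@lt_trans _ _ ((e / 4)%:C%C + (e / 2)%:C%C)).
  by apply: ltr_leD => //; rewrite (le_trans fB_le) // lecR ltW.
by rewrite -rmorphD ltcR; lra.
Qed.

End UnorderedSums.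

(** * Functionals on the direct sum of matrix blocks *)

Section ExtendedSums.
Local Open Scope classical_set_scope.

Lemma esum_scale_lty (R : realType) (I : choiceType) (g : I -> R) (c : R) :
    0 <= c -> (forall i, 0 <= g i) -> (\esum_(i in [set: I]) (g i)%:E < +oo)%E ->
  (\esum_(i in [set: I]) (g i * c)%:E < +oo)%E.
Proof.
move=> c0 g0 g_fin; pose S := (\esum_(i in [set: I]) (g i)%:E)%E.
have S_fin : S \is a fin_num.
  by rewrite ge0_fin_numE // esum_ge0 // => i _; rewrite lee_fin.
apply: (@le_lt_trans _ _ (fine S * c)%:E); last exact: ltry.
apply: ge_ereal_sup => _ [X [finX _] <-].
rewrite fsbig_finite // sumEFin lee_fin -mulr_suml ler_wpM2r //.
rewrite -lee_fin fineK //; apply: esum_ge; exists X; first by split.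
by rewrite fsbig_finite // sumEFin.
Qed.

Lemma esum_indicator_lty (R : realType) (I : choiceType) (i0 : I) :
  (\esum_(i in [set: I]) (((i == i0)%:R : R))%:E < +oo)%E.
Proof.
rewrite (_ : \esum_(i in [set: I]) _ = 1%E) ?ltry //.
rewrite -(@esum_set1 _ _ i0 (fun=> 1%E) lee01) [RHS]esum_mkcond.
by apply: eq_esum => i _; rewrite in_set1; case: eqP.
Qed.

End ExtendedSums.

Section Slices.
Variables (R : realType) (N : nat) (n : Sign N -> nat) (F : blocks R n).
Local Notation C := R[i].

(** The components of both [chi_sign] and [chi_mix] are scalar multiples of this state, by an
    indicator and by [P] respectively, which allows a common treatment. *)
Definition density_state (nu : Sign N) (a : 'M[C]_(n nu)) : C :=
  \tr (F nu *m a) / \tr (F nu).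

Lemma embed_block_id (nu : Sign N) (a : 'M[C]_(n nu)) : embed_block a nu = a.
Proof.
by rewrite /embed_block; case: eqP => // e; rewrite (eq_irrelevance e erefl).
Qed.

Lemma embed_block_neq (nu mu : Sign N) (a : 'M[C]_(n nu)) :
  mu != nu -> embed_block a mu = 0.
Proof. by rewrite /embed_block; case: eqP => // e /eqP/(_ (esym e)). Qed.

Lemma component_chi_sign (nu mu : Sign N) (a : 'M[C]_(n mu)) :
  component (chi_sign F nu) a = ((mu == nu)%:R%:C)%C * density_state a.
Proof.
rewrite /component /chi_sign; have [e|ne] := eqVneq mu nu.
  by rewrite -e embed_block_id mul1r.
by rewrite embed_block_neq 1?eq_sym // mulmx0 mxtrace0 !mul0r.
Qed.

Lemma component_chi_mix (P : Sign N -> R) (mu : Sign N) (a : 'M[C]_(n mu)) :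
  component (chi_mix F P) a = ((P mu)%:C)%C * density_state a.
Proof.
rewrite /component /chi_mix.
pose f nu := ((P nu)%:C)%C * chi_sign F nu (embed_block a).
have -> : ((P mu)%:C)%C * density_state a = f mu.
  by rewrite /f /chi_sign embed_block_id.
apply/csumE/has_sum_support1 => nu ne.
by rewrite /f /chi_sign embed_block_neq // mulmx0 mxtrace0 mul0r mulr0.
Qed.

Hypothesis F_psd : forall nu (v : 'cV[C]_(n nu)),
  0 <= ((map_mx Num.conj v)^T *m F nu *m v) 0 0.
Hypothesis F_trace : forall nu, 0 < \tr (F nu).

Lemma density_state_bound nu (a : 'M[C]_(n nu)) (r : R) : opnorm_le a r ->
  `|density_state a| <= (r%:C)%C.
Proof.
move=> ar; rewrite normrM normfV (ger0_norm (ltW (F_trace nu))).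
by rewrite ler_pdivrMr ?F_trace // mulrC trace_psd_bound.
Qed.

(** Since [density_state] has norm at most 1, the coefficients [c] themselves bound the norms of the
    components. *)
Lemma normal_functional_density (chi : blocks R n -> C) (c : Sign N -> R) :
    (forall nu, 0 <= c nu) -> (\esum_(nu in [set: Sign N]) (c nu)%:E < +oo)%E ->
    (forall nu (a : 'M[C]_(n nu)), component chi a = ((c nu)%:C)%C * density_state a) ->
    (forall x, in_wstar x -> has_sum (fun nu => component chi (x nu)) (chi x)) ->
  normal_functional chi.
Proof.
move=> c0 c_fin compE chiE; exists c; split=> // nu.
  move=> l a b; rewrite !compE /density_state mulmxDr linearD /= -scalemxAr linearZ /=.
  ring.
move=> a r ar; rewrite compE normrM rmorphM ger0_norm; last first.
  by rewrite -[0]/(0%:C)%C lecR.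
by rewrite ler_wpM2l ?density_state_bound // -[0]/(0%:C)%C lecR.
Qed.

Lemma normal_functional_chi_sign nu : normal_functional (chi_sign F nu).
Proof.
apply: (@normal_functional_density _ (fun mu => (mu == nu)%:R)) => //.
- exact: esum_indicator_lty.
- exact: component_chi_sign.
move=> x _; have -> : chi_sign F nu x = component (chi_sign F nu) (x nu).
  by rewrite component_chi_sign eqxx mul1r.
apply: has_sum_support1 (fun mu => component (chi_sign F nu) (x mu)) _ _ => mu ne.
by rewrite component_chi_sign (negbTE ne) mul0r.
Qed.

Lemma state_functional_chi_sign nu : state_functional (chi_sign F nu).
Proof.
split; first by rewrite /chi_sign mulmx1 divff // gt_eqF.
move=> x _; apply: divr_ge0; last exact: ltW; exact: trace_psd_gram.
Qed.

Lemma normal_functional_chi_mix (P : Sign N -> R) :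
  is_probability P -> normal_functional (chi_mix F P).
Proof.
move=> [P0 P1]; have P_fin : (\esum_(nu in [set: Sign N]) (P nu)%:E < +oo)%E.
  by rewrite P1 ltry.
apply: (@normal_functional_density _ P) => //; first exact: component_chi_mix.
move=> x [c xc].
have [s fs] : exists s, has_sum (fun nu => ((P nu)%:C)%C * chi_sign F nu x) s.
  (* [csum] has its intended value only on summable families. The absolute value makes the bound
     nonnegative without choosing a signature at which to use [xc]. *)
  apply: (has_sum_dominated (g := fun nu => P nu * `|c|)).
    move=> nu; rewrite normrM rmorphM ger0_norm; last by rewrite -[0]/(0%:C)%C lecR.
    apply: ler_wpM2l; first by rewrite -[0]/(0%:C)%C lecR.
    by rewrite (le_trans (density_state_bound (xc nu))) // lecR ler_norm.
  exact: esum_scale_lty.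
have -> : chi_mix F P x = s by apply: csumE.
suff -> : (fun nu => component (chi_mix F P) (x nu)) =
          (fun nu => ((P nu)%:C)%C * chi_sign F nu x) by [].
by apply/funext => nu; rewrite component_chi_mix.
Qed.

Variables (A : cstarAlgType R) (U : forall nu, 'M[A]_(n nu)).
Variable piT : A -> 'rV[C]_N -> C.

(** Expanding the matrix of torus values in matrix units turns the double sum of [slice_term] into
    one application of the functional. *)
Lemma slice_term_density (chi : blocks R n -> C) nu (c : C) z :
    (forall a : 'M[C]_(n nu), component chi a = c * density_state a) ->
  slice_term U piT chi nu z = c * density_state (map_mx (piT^~ z) (U nu)).
Proof.
move=> compE; rewrite [X in _ = _ * density_state X](matrix_sum_delta (map_mx (piT^~ z) (U nu))).
rewrite /density_state mulmx_sumr linear_sum /= mulr_suml mulr_sumr.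
apply: eq_bigr => i _; rewrite mulmx_sumr linear_sum /= mulr_suml mulr_sumr.
apply: eq_bigr => j _; rewrite compE /density_state -scalemxAr linearZ /= mxE.
ring.
Qed.

End Slices.

(** * Slices of V_N along the states chi_nu and their mixtures *)

Lemma norm_exprz_eq1 (F : numFieldType) (x : F) (a : int) : `|x| = 1 -> `|x ^ a| = 1.
Proof.
by move=> x1; case: a => k; rewrite ?NegzE ?exprnN ?normfV normrX x1 expr1n ?invr1.
Qed.

Theorem theorem3p2 (R : realType) (q : R) (N : nat)
  (q_gt0 : 0 < q) (q_lt1 : q < 1) (N_gt0 : (0 < N)%N)
  (* U_q(N) = (A, delta) *)
  (A : cstarAlgType R) (u : 'M[A]_N) (d : A)
  (A_univ : is_quantum_unitary_group q u d)
  (T : cstarAlgType R) (i1 i2 : A -> T) (T_min : is_min_tensor i1 i2)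
  (delta : A -> T) (delta_comul : is_comultiplication i1 i2 u delta)
  (K : {ffun 'I_N -> int} -> A -> R[i]) (E : 'I_N -> A -> R[i])
  (KE_pairing : gl_pairing q u d K E)
  (* the irreducible representations U_nu and their density matrices F_nu *)
  (n : Sign N -> nat) (U : forall nu : Sign N, 'M[A]_(n nu))
  (F : forall nu : Sign N, 'M[R[i]]_(n nu))
  (U_unitary : forall nu, unitary_rep i1 i2 delta (U nu))
  (U_irr : forall nu, irreducible_rep (U nu))
  (U_hw : forall nu, highest_weight q u d K E (U nu) (sign_part nu))
  (F_density : forall nu, density_matrix (U nu) (F nu))
  (U_gt : forall nu, exists P gt, gt_basis q K nu (U nu) (F nu) P gt)
  (* the restriction to the torus *)
  (piT : A -> 'rV[R[i]]_N -> R[i]) (piT_hom : is_torus_hom u d piT) :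
  (forall nu : Sign N,
     normal_functional (chi_sign F nu) /\ state_functional (chi_sign F nu) /\
     forall z, torus z ->
       slice U piT (chi_sign F nu) z =
       schur nu (qtwist q z) / schur nu (qtwist q (const_mx 1))) /\
  (forall P : Sign N -> R, is_probability P ->
     normal_functional (chi_mix F P) /\
     has_usum (@torus R N) (fun nu z => slice_term U piT (chi_mix F P) nu z)
       (slice U piT (chi_mix F P)) /\
     (forall z, torus z ->
       has_sum (fun nu => (P nu)%:C%C * slice U piT (chi_sign F nu) z)
         (slice U piT (chi_mix F P) z)) /\
     (forall z, torus z ->
       slice U piT (chi_mix F P) z = generating_function q P (qtwist q z))).
Proof.
have [rel _] := A_univ.
have F_psd nu (v : 'cV[R[i]]_(n nu)) : 0 <= ((map_mx Num.conj v)^T *m F nu *m v) 0 0.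
  by case: (F_density nu) => _ psd _ _; apply: psd.
have n_gt0 nu : (0 < n nu)%N by case: (U_irr nu).
(* The trace is a sum of positive powers of q over the patterns, nonempty since an irreducible
   representation has positive dimension. *)
have F_trace nu : 0 < \tr (F nu).
  have [P [gt gtb]] := U_gt nu; rewrite (trace_density gtb).
  rewrite (bigD1 (Ordinal (n_gt0 nu))) //= ltr_pwDl ?gt_density_gt0 //.
  by apply: sumr_ge0 => k _; rewrite ltW ?gt_density_gt0.
have state_schur nu z : torus z ->
    density_state F (map_mx (piT^~ z) (U nu)) =
    schur nu (qtwist q z) / schur nu (qtwist q (const_mx 1)).
  move=> tz; have [P [gt gtb]] := U_gt nu; have [U_hopf _] := U_hw nu.
  rewrite /density_state.
  rewrite (trace_torus q_gt0 q_lt1 N_gt0 rel KE_pairing piT_hom T_min delta_comul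
    (U_unitary nu) U_hopf gtb tz).
  rewrite (sum_gt_density_schur q_gt0 q_lt1 N_gt0 gtb tz).
  rewrite (trace_density_schur q_gt0 q_lt1 N_gt0 gtb) -mulf_div divff ?mul1r //.
  by rewrite expfz_neq0 // qC_neq0.
(* On the torus every monomial z^weight has modulus 1, so the trace is at most the sum of the
   density entries. This makes [P] the majorant for uniform convergence. *)
have state_le1 nu z : torus z -> `|density_state F (map_mx (piT^~ z) (U nu))| <= 1.
  move=> tz; have [P [gt gtb]] := U_gt nu; have [U_hopf _] := U_hw nu.
  rewrite normrM normfV (ger0_norm (ltW (F_trace nu))).
  rewrite ler_pdivrMr ?F_trace // mul1r.
  rewrite (trace_torus q_gt0 q_lt1 N_gt0 rel KE_pairing piT_hom T_min delta_comul
    (U_unitary nu) U_hopf gtb tz) (trace_density gtb).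
  apply: (le_trans (ler_norm_sum _ _ _)); apply: ler_sum => k _.
  rewrite normrM (ger0_norm (ltW (gt_density_gt0 q_gt0 nu (gt k)))).
  rewrite normr_prod big1 ?mulr1 // => i _; exact/norm_exprz_eq1/tz.
have slice_sign nu z : slice U piT (chi_sign F nu) z =
    density_state F (map_mx (piT^~ z) (U nu)).
  have termE mu : slice_term U piT (chi_sign F nu) mu z =
      ((mu == nu)%:R%:C)%C * density_state F (map_mx (piT^~ z) (U mu)).
    by apply: slice_term_density; apply: component_chi_sign.
  have -> : density_state F (map_mx (piT^~ z) (U nu)) =
      slice_term U piT (chi_sign F nu) nu z by rewrite termE eqxx mul1r.
  apply/csumE/has_sum_support1 => mu ne.
  by rewrite termE (negbTE ne) mul0r.
split=> [nu|P P_prob].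
  split; first exact: normal_functional_chi_sign.
  split; first exact: state_functional_chi_sign.
  by move=> z tz; rewrite slice_sign state_schur.
have [P_ge0 P_sum] := P_prob.
have P_fin : (\esum_(nu in [set: Sign N]%classic) (P nu)%:E < +oo)%E by rewrite P_sum ltry.
have termE nu z : slice_term U piT (chi_mix F P) nu z =
    ((P nu)%:C)%C * density_state F (map_mx (piT^~ z) (U nu)).
  by apply: slice_term_density; apply: component_chi_mix.
have usum : has_usum (@torus R N) (fun nu z => slice_term U piT (chi_mix F P) nu z)
    (slice U piT (chi_mix F P)).
  apply: (has_usum_dominated (g := P)) => // nu z tz.
  rewrite termE normrM ger0_norm; last by rewrite -[0]/(0%:C)%C lecR.
  by rewrite ler_piMr ?state_le1 // -[0]/(0%:C)%C lecR.
split; first exact: normal_functional_chi_mix.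
split=> //; split=> z tz.
  have -> : (fun nu => ((P nu)%:C)%C * slice U piT (chi_sign F nu) z) =
      (fun nu => slice_term U piT (chi_mix F P) nu z).
    by apply/funext => nu; rewrite termE slice_sign.
  by move=> e e0; have [A0 H] := usum e e0; exists A0 => B AB [] _; apply: H.
rewrite /slice /generating_function; congr (csum _); apply/funext => nu.
by rewrite termE state_schur.
Qed.
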